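(* Let $G$ be a $3$-tree with chromatic index $\chi'(G)$. Then $\mathrm{ch}'(G)=\chi'(G)$.
   Context: Graphs are finite and simple. A $3$-tree is a graph that can be constructed from the complete graph on $4$ vertices by iteratively (zero or more times) adding a new vertex and connecting it to all vertices of a complete subgraph of order $3$ (equivalently, an edge-maximal graph of tree-width $3$). An assignment of lists for $G$ is a map $L:E(G)\to\mathcal P(\mathbb N)$. An $L$-edge-colouring of $G$ is a function $\mathcal C:E(G)\to\mathbb N$ with $\mathcal C(e)\in L(e)$ for each edge $e$ and such that no two adjacent edges receive the same colour. $G$ is $k$-edge-choosable if for each assignment of lists $L$ with $|L(e)|\ge k$ for all $e$ there is an $L$-edge-colouring. The list chromatic index $\mathrm{ch}'(G)$ is the smallest $k$ for which $G$ is $k$-edge-choosable. $\chi'(G)$ is the usual chromatic index (minimum number of colours in a proper edge-colouring). *)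

(* Defs.v *)
From mathcomp Require Import boolp classical_sets functions cardinality.
(* Loaded after classical_sets so that set0, setT, ... are those of finset. *)
From mathcomp Require Import all_boot.

Set Implicit Arguments.
Unset Strict Implicit.
Unset Printing Implicit Defensive.

Local Open Scope card_scope.

Definition pairs (T : finType) (A : {set T}) : {set {set T}} :=
  [set e : {set T} | (e \subset A) && (#|e| == 2)].

(* The vertex set is a subset of an ambient finite type T, so that a vertex
   can be added to a graph without changing types. *)
Record sgraph (T : finType) := SGraph {
  vertices : {set T};
  edges : {set {set T}};
  edges_pairs : edges \subset pairs vertices }.

Inductive three_tree_on (T : finType) : {set T} -> {set {set T}} -> Prop :=
| Complete4 (V : {set T}) : #|V| = 4 -> three_tree_on V (pairs V)
| AddVertex (V : {set T}) (E : {set {set T}}) (K : {set T}) (v : T) :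
    three_tree_on V E -> v \notin V ->
    K \subset V -> #|K| = 3 -> pairs K \subset E ->
    three_tree_on (v |: V) (E :|: [set [set u; v] | u in K]).

Definition three_tree (T : finType) (G : sgraph T) : Prop :=
  three_tree_on (vertices G) (edges G).

Definition adjacent_edges (T : finType) (e f : {set T}) : bool :=
  (e != f) && (e :&: f != set0).

(* Lists and colourings are total functions on {set T}; only their values on
   the edges of G matter. Lists are arbitrary, possibly infinite, subsets of
   nat. *)
Definition list_edge_colouring (T : finType) (G : sgraph T)
    (L : {set T} -> classical_sets.set nat) (c : {set T} -> nat) : Prop :=
  (forall e, e \in edges G -> L e (c e)) /\
  (forall e f, e \in edges G -> f \in edges G ->
     adjacent_edges e f -> c e <> c f).

Definition edge_colourable (T : finType) (G : sgraph T) (k : nat) : Prop :=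
  exists c : {set T} -> nat,
    list_edge_colouring G (fun=> `I_k%classic) c.

Definition edge_choosable (T : finType) (G : sgraph T) (k : nat) : Prop :=
  forall L : {set T} -> classical_sets.set nat,
    (forall e, e \in edges G -> `I_k%classic #<= L e) ->
    exists c : {set T} -> nat, list_edge_colouring G L c.

Lemma card_le_fresh (A : classical_sets.set nat) k (s : seq nat) :
  `I_k%classic #<= A -> size s < k -> exists2 x, A x & x \notin s.
Proof.
move=> /pcard_leP[f] sk; apply: contrapT => nofresh.
have fs i : i < k -> f i \in s.
  move=> ik; apply/negPn/negP => fi; apply: nofresh; exists (f i) => //.
  exact: (@funS _ _ _ _ f i ik).
have : size (map f (iota 0 k)) <= size s.
  apply: uniq_leq_size.
    rewrite map_inj_in_uniq ?iota_uniq // => i j.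
    rewrite !mem_iota /= !add0n => ik jk fij.
    by apply: (@inj _ _ _ f) fij; apply: mem_set.
  by move=> _ /mapP[i + ->]; rewrite mem_iota => /fs.
by rewrite size_map size_iota leqNgt sk.
Qed.

Lemma edge_choosable_card (T : finType) (G : sgraph T) :
  edge_choosable G #|edges G|.
Proof.
move=> L HL.
suff [c [cL cinj]] : exists c : {set T} -> nat,
    (forall e, e \in enum (edges G) -> L e (c e)) /\
    {in enum (edges G) &, injective c}.
  exists c; split=> [e eG|e f eG fG /andP[ef _] cef].
    by apply: cL; rewrite mem_enum.
  by move/eqP: ef; apply; apply: cinj; rewrite ?mem_enum.
have : uniq (enum (edges G)) by exact: enum_uniq.
have : {subset enum (edges G) <= edges G} by move=> e; rewrite mem_enum.
have : size (enum (edges G)) <= #|edges G| by rewrite -cardE.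
elim: (enum (edges G)) => [|e s IH] /= sz sub; first by exists (fun=> 0).
move=> /andP[es us].
have [||c [cL cinj]] := IH _ _ us; first exact: ltnW.
  by move=> f fs; apply: sub; rewrite inE fs orbT.
have eG : e \in edges G by apply: sub; rewrite mem_head.
have [|x Lx xs] := @card_le_fresh (L e) _ (map c s) (HL e eG).
  by rewrite size_map.
exists (fun f => if f == e then x else c f); split=> [f|f g].
  by rewrite inE; case: eqP => [-> _|_] //=; exact: cL.
have cx h : h \in s -> c h <> x.
  by move=> hs chx; rewrite -chx map_f in xs.
rewrite !inE; case: eqP => [->|_] /=; case: eqP => [->|_] //= hf hg.
- by move/esym/cx; case.
- by move/cx; case.
- exact: cinj.
Qed.

Lemma edge_colourable_card (T : finType) (G : sgraph T) :
  edge_colourable G #|edges G|.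
Proof. by apply: edge_choosable_card => e _; exact: card_lexx. Qed.

Lemma ex_edge_colourable (T : finType) (G : sgraph T) :
  exists k, `[< edge_colourable G k >].
Proof. by exists #|edges G|; apply/asboolP; exact: edge_colourable_card. Qed.

Lemma ex_edge_choosable (T : finType) (G : sgraph T) :
  exists k, `[< edge_choosable G k >].
Proof. by exists #|edges G|; apply/asboolP; exact: edge_choosable_card. Qed.

Definition chromatic_index (T : finType) (G : sgraph T) : nat :=
  ex_minn (ex_edge_colourable G).

Definition list_chromatic_index (T : finType) (G : sgraph T) : nat :=
  ex_minn (ex_edge_choosable G).

(* Main.v *)
Require Import Defs.
From mathcomp Require Import all_boot.
From mathcomp Require Import all_order all_algebra.
From mathcomp Require Import ring zify.

(** Let [k] be the chromatic index, so that [k] is at least the maximum degree.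
    A [k]-edge-colouring is extended from a smaller graph to a few uncoloured
    edges, whose remaining lists are bounded below by counting; such small
    configurations are handled by Galvin's kernel method (bipartite ones) or by
    the Alon-Tarsi theorem applied to their line graph.
    - [k >= 7]: the claim holds for every subgraph [F] of a 3-tree. In a minimal
      counterexample adjacent vertices have degree sum at least [k + 2]. The last
      vertex [v] of degree at least [(k + 2) / 2] in the construction order then
      has degree at least [k - 1], and all its later neighbours have degree 2 or
      3 and all their neighbours among [v] and three further vertices.
    - [k = 6]: the sum of [6 - deg v] over all vertices is 12. With at least 9
      vertices this forces a vertex of degree 4 next to a leaf (a vertex of
      degree 3) and to a vertex of degree less than 6, and the leaf is reducible.
    - 3-trees with at least 7 vertices have maximum degree at least 6; up to
      isomorphism twelve 3-trees remain, and for them [k] is the maximum degree,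
      except for K5 minus an edge, whose 9 edges need 5 colours. *)

Set Implicit Arguments.
Unset Strict Implicit.
Unset Printing Implicit Defensive.

Import Order.TTheory GRing.Theory Num.Theory.

(** * The Alon-Tarsi theorem *)

(** The threshold 7 comes from counting leaves. At most three neighbours of [v] lie in [N], so at
    least [deg v - 3] are leaves. If [deg v = k], any four leaves contain a reducible set. If
    [deg v = k - 1], all leaves have degree 3, and three of them suffice once two have the same
    neighbours. Otherwise [k = 7] and three leaves form a hexagon with [N]; together with [v] it
    contains triangles, so Galvin's theorem does not apply and Alon-Tarsi is used. For [k = 6] the
    same count gives too few leaves. The induction then deletes leaves instead of edges and so stays
    among 3-trees, whose degree sum is known exactly; this sum, which arbitrary subgraphs do not
    control, produces the configuration. The finite configurations are settled by evaluation:
    preference orders and exponent vectors are stored as certificates and only validated. *)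

Section Lagrange.
Local Open Scope ring_scope.
Variable K : fieldType.

(** Lagrange interpolation of ['X^e] at the [d + 1] points of [s] is exact because [e <= d]; the
    identity compares the coefficients of degree [d]. *)
Lemma lagrange_moment (s : seq K) (d e : nat) :
  uniq s -> size s = d.+1 -> (e <= d)%N ->
  \sum_(a <- s) a ^+ e / \prod_(b <- s | b != a) (a - b) = (e == d)%:R.
Proof.
move=> us sz ed.
pose N a : K := \prod_(b <- s | b != a) (a - b).
pose B a : {poly K} := \prod_(b <- s | b != a) ('X - b%:P).
have N0 a : N a != 0.
  rewrite prodf_seq_neq0; apply/allP => b _; apply/implyP => ba.
  by rewrite subr_eq0 eq_sym.
have szB a : a \in s -> size (B a) = d.+1.
  move=> ain; rewrite /B -big_filter size_prod_XsubC.
  rewrite -rem_filter // size_rem // sz //.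
have lB a : a \in s -> (B a)`_d = 1.
  move=> ain; have /eqP : B a \is monic.
    exact: monic_prod_XsubC.
  by rewrite /lead_coef szB.
have hB a b : b \in s -> (B a).[b] = if b == a then N a else 0.
  move=> bin; rewrite /B horner_prod; case: eqP => [->|/eqP ba].
    by apply: eq_bigr => c _; rewrite !hornerE.
  apply/eqP; rewrite prodf_seq_eq0; apply/hasP; exists b => //.
  by rewrite ba !hornerE subrr eqxx.
pose q : {poly K} := \sum_(a <- s) (a ^+ e / N a) *: B a.
(* The difference has degree at most [d] and vanishes at all [d + 1] points of [s]. *)
have : 'X^e - q == 0.
  apply: contraT => nz.
  have ub : (size ('X^e - q)%R <= d.+1)%N.
    rewrite (leq_trans (size_polyD _ _)) // size_polyN geq_max size_polyXn ltnS ed.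
    rewrite (leq_trans (size_sum _ _ _)) //.
    apply/bigmax_leqP_seq => a ain _.
    by rewrite (leq_trans (size_scale_leq _ _)) // szB.
  suff al : all (root ('X^e - q)) s.
    by have := max_poly_roots nz al us; rewrite sz ltnNge ub.
  apply/allP => b bin; rewrite /root /q !hornerE horner_sum subr_eq0.
    rewrite (bigD1_seq b) //= big_seq_cond big1.
      by rewrite addr0 !hornerE hB // eqxx divfK.
    move=> a /andP[ain ab]; by rewrite hornerZ hB // eq_sym (negbTE ab) mulr0.
rewrite subr_eq0 => /eqP /(congr1 (fun p : {poly K} => p`_d)).
rewrite coefXn eq_sym => ->; rewrite /q coef_sum.
by apply: eq_big_seq => a ain; rewrite coefZ lB // mulr1.
Qed.

End Lagrange.

Section AlonTarsi.

Definition occ (l : seq (nat * nat)) (v : nat) : nat :=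
  count (fun p => (p.1 == v) || (p.2 == v)) l.

Definition decr (d : seq nat) (v : nat) : seq nat := set_nth 0 d v (nth 0 d v).-1.

(* Coefficient of the monomial with exponents [d] in the product of the
   [x_i - x_j] over [(i, j)] in [l]; branches that cannot reach [d] are cut. *)
Fixpoint graph_coef (l : seq (nat * nat)) (d : seq nat) : int :=
  if l is (i, j) :: l' then
    let branch a b :=
      if [&& 0 < nth 0 d a, (nth 0 d a).-1 <= occ l' a & nth 0 d b <= occ l' b]
      then graph_coef l' (decr d a) else 0%R in
    (branch i j - branch j i)%R
  else 1%R.

Variables (m M : nat) (A : 'I_m -> {set 'I_M}).
Local Open Scope ring_scope.

(** The Lagrange weights of the list [A i]: by [wt_moment], summing against them kills the powers
    below [#|A i| - 1] and sends the power [#|A i| - 1] to 1. *)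
Let wt (i : 'I_m) (a : 'I_M) : rat :=
  if a \in A i then
    (\prod_(b <- [seq (b%:R : rat) | b : 'I_M in A i] | b != a%:R) (a%:R - b))^-1
  else 0.

Let xv (f : {ffun 'I_m -> 'I_M}) (v : nat) : rat :=
  oapp (fun i => (f i)%:R) 0 (insub v : option 'I_m).

(* A linear functional of the polynomial with exponents [e] times the product
   over [l], supported on the list assignments; by [lagrange_moment] it reads off
   the coefficient of the monomial with exponents [#|A i| - 1]. *)
Let gsum (l : seq (nat * nat)) (e : nat -> nat) : rat :=
  \sum_(f : {ffun 'I_m -> 'I_M})
     (\prod_i (wt i (f i) * (f i)%:R ^+ e i)) * \prod_(p <- l) (xv f p.1 - xv f p.2).

Let incr (e : nat -> nat) (v : nat) : nat -> nat := fun u => (e u + (u == v))%N.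

Lemma gsum_cons i j l e : (i < m)%N -> (j < m)%N ->
  gsum ((i, j) :: l) e = gsum l (incr e i) - gsum l (incr e j).
Proof.
move=> im jm; rewrite /gsum -sumrB; apply: eq_bigr => f _.
have mul v : (v < m)%N ->
   \prod_k (wt k (f k) * (f k)%:R ^+ incr e v k)
   = (\prod_k (wt k (f k) * (f k)%:R ^+ e k)) * xv f v.
  move=> vm; rewrite /xv insubT /= (bigD1 (Ordinal vm)) //=.
  rewrite [in RHS](bigD1 (Ordinal vm)) //= /incr eqxx addn1 exprSr.
  rewrite (eq_bigr (fun k => wt k (f k) * (f k)%:R ^+ e k)); first by ring.
  by move=> k kv; rewrite (_ : (k == v :> nat) = false) ?addn0 //; apply/negbTE.
rewrite !mul // big_cons /=; ring.
Qed.

Lemma incr_sum (e : nat -> nat) v : (v < m)%N ->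
  (\sum_(i < m) (incr e v i).+1 = (\sum_(i < m) (e i).+1).+1)%N.
Proof.
move=> vm; rewrite (bigD1 (Ordinal vm)) //= [in RHS](bigD1 (Ordinal vm)) //=.
rewrite /incr eqxx addn1 addSn; congr (_ + _).+1.
apply: eq_bigr => k kv; rewrite (_ : (k == v :> nat) = false) ?addn0 //.
exact/negbTE.
Qed.

Lemma wt_moment (i : 'I_m) e : (e < #|A i|)%N ->
  \sum_(a : 'I_M) wt i a * a%:R ^+ e = (e.+1 == #|A i|)%:R.
Proof.
case dE: #|A i| => [//|d]; rewrite ltnS eqSS => eid.
set s := [seq (b%:R : rat) | b : 'I_M in A i].
have us : uniq s.
  by rewrite map_inj_uniq ?enum_uniq // => a b /eqP; rewrite eqr_nat => /eqP /val_inj.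
have szs : size s = d.+1 by rewrite size_map -cardE.
rewrite -(lagrange_moment us szs eid) big_map big_enum /= [RHS]big_mkcond.
by apply: eq_bigr => a _; rewrite /wt; case: (a \in A i); rewrite ?mul0r // mulrC.
Qed.

Lemma gsum_nil e :
  gsum [::] e = \prod_i \sum_(a : 'I_M) wt i a * a%:R ^+ e i.
Proof.
rewrite bigA_distr_bigA; apply: eq_bigr => f _; by rewrite big_nil mulr1.
Qed.

Lemma gsum_nil0 (e : nat -> nat) (b : 'I_m) : ((e b).+1 < #|A b|)%N -> gsum [::] e = 0.
Proof.
move=> eb; rewrite gsum_nil (bigD1 b) //= wt_moment; last exact: ltnW.
by rewrite ltn_eqF // mul0r.
Qed.

Definition loopless (l : seq (nat * nat)) : bool :=
  all (fun p => [&& p.1 < m, p.2 < m & p.1 != p.2])%N l.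

(** Expanding the factors in [l] raises the exponent of [b] to at most [e b + occ l b], so in every
    monomial the moment at [b] vanishes. *)
Lemma gsum_small l (e : nat -> nat) (b : 'I_m) : loopless l ->
  ((e b + occ l b).+1 < #|A b|)%N -> gsum l e = 0.
Proof.
elim: l e => [|[i j] l IH] e /=.
  by move=> _; rewrite addn0; exact: gsum_nil0.
move=> /andP[/and3P[/= im jm ij] ll] h; rewrite gsum_cons // !IH ?subrr //.
all: apply: leq_trans h; rewrite !ltnS /incr -addnA leq_add2l leq_add2r.
  by rewrite [j == b]eq_sym; case: eqP => // _; rewrite orbT.
by rewrite [i == b]eq_sym; case: eqP.
Qed.

(** [wt_moment] says nothing about exponents of size [#|A b|] or more. The total degree is that of
    the target monomial, so an exponent above its target at [b] forces one below its target
    elsewhere, and the moment there vanishes. *)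
Lemma gsum_large l (e : nat -> nat) (b : 'I_m) : loopless l ->
  (\sum_(i < m) (e i).+1 + size l = \sum_(i < m) #|A i|)%N ->
  (#|A b| <= e b)%N -> gsum l e = 0.
Proof.
elim: l e => [|[i j] l IH] e /=.
  move=> _; rewrite addn0 => se eb.
  have [c ec] : exists c : 'I_m, ((e c).+1 < #|A c|)%N.
    apply/existsP; apply: contraT; rewrite negb_exists => /forallP h.
    suff : (\sum_(i < m) #|A i| < \sum_(i < m) (e i).+1)%N by rewrite se ltnn.
    rewrite (bigD1 b) //= [in ltnRHS](bigD1 b) //= -addSn leq_add // leq_sum //.
    by move=> i _; rewrite leqNgt h.
  exact: gsum_nil0 ec.
move=> /andP[/and3P[/= im jm ij] ll] h eb.
rewrite gsum_cons // !IH ?subrr //.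
- by rewrite incr_sum // addSnnS.
- by rewrite (leq_trans eb) // leq_addr.
- by rewrite incr_sum // addSnnS.
- by rewrite (leq_trans eb) // leq_addr.
Qed.

(** [e] holds the exponents already collected and [d] those still required. Each branch cut by
    [graph_coef] contributes 0: an exponent that overshoots by [gsum_large], one that can no longer
    be reached by [gsum_small]. *)
Lemma gsum_coef l (e : nat -> nat) d : loopless l ->
  (\sum_(i < m) (e i).+1 + size l = \sum_(i < m) #|A i|)%N ->
  (forall i : 'I_m, (e i + nth 0 d i).+1 = #|A i|)%N ->
  gsum l e = (graph_coef l d)%:~R.
Proof.
elim: l e d => [|[i j] l IH] e d /=.
  move=> _; rewrite addn0 => se ed; rewrite gsum_nil big1 // => i _.
  have h : [forall i : 'I_m, (e i).+1 == #|A i|].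
    apply: contraT; rewrite negb_forall => /existsP[b hb].
    suff : (\sum_(i < m) (e i).+1 < \sum_(i < m) #|A i|)%N by rewrite se ltnn.
    rewrite (bigD1 b) //= [in ltnRHS](bigD1 b) //= -addSn leq_add ?leq_sum //.
      by rewrite ltn_neqAle hb -ed ltnS leq_addr.
    by move=> k _; rewrite -ed ltnS leq_addr.
  by rewrite wt_moment (eqP (forallP h i)) // eqxx.
move=> /andP[/and3P[/= im jm ij] ll] se ed.
have branchE a b (am : (a < m)%N) (bm : (b < m)%N) : a != b ->
  gsum l (incr e a) =
  (if [&& 0 < nth 0 d a, (nth 0 d a).-1 <= occ l a & nth 0 d b <= occ l b]%N
   then graph_coef l (decr d a) else 0)%:~R.
  move=> ab; have eda := ed (Ordinal am); have edb := ed (Ordinal bm).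
  have sa : (\sum_(i < m) (incr e a i).+1 + size l = \sum_(i < m) #|A i|)%N.
    by rewrite incr_sum // addSnnS.
  case: and3P => [[h1 h2 h3]|hn].
    apply: IH => // k; rewrite /decr nth_set_nth /incr /= -ed.
    by case: eqP => [->|]; lia.
  have [da0|h1] := posnP (nth 0%N d a).
    by apply: (@gsum_large _ _ (Ordinal am)) => //; rewrite /incr eqxx -eda da0; lia.
  have [h2|h2] := leqP (nth 0%N d a).-1 (occ l a); last first.
    by apply: (@gsum_small _ _ (Ordinal am)) => //; rewrite /incr eqxx -eda /=; lia.
  have [h3|h3] := leqP (nth 0%N d b) (occ l b).
    by case: hn.
  apply: (@gsum_small _ _ (Ordinal bm)) => //.
  by rewrite /incr -edb /= eq_sym (negbTE ab); lia.
by rewrite gsum_cons // (branchE i j) // (branchE j i) 1?eq_sym // -rmorphB.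
Qed.

(** Without a proper colouring from the lists, every summand of [gsum l (fun=> 0)] has a zero weight
    or a zero factor, so the coefficient would be 0. *)
Lemma graph_coef_colourable l d : loopless l ->
  (\sum_(i < m) nth 0 d i = size l)%N -> (forall i : 'I_m, #|A i| = (nth 0 d i).+1)%N ->
  graph_coef l d != 0 ->
  exists f : {ffun 'I_m -> 'I_M}, (forall i, f i \in A i) /\
    forall i j : 'I_m, (val i, val j) \in l -> f i != f j.
Proof.
move=> ll sd hA cf.
have /existsP[f /andP[/forallP fA /forallP fl]] : [exists f : {ffun 'I_m -> 'I_M},
    [forall i, f i \in A i] &&
    [forall i : 'I_m, forall j : 'I_m, ((val i, val j) \in l) ==> (f i != f j)]].
  apply: contraNT cf => /existsPn hno.
  rewrite -(intr_eq0 rat) -(@gsum_coef l (fun=> 0%N) d) //; last first.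
    by rewrite -sd -big_split /=; apply: eq_bigr => i _; rewrite hA addSn.
  rewrite /gsum big1 // => f _.
  have [fA|] := boolP [forall i, f i \in A i]; last first.
    rewrite negb_forall => /existsP[i fi].
    by rewrite (bigD1 i) //= /wt (negbTE fi) !mul0r.
  have := hno f; rewrite fA negb_forall => /existsP[i].
  rewrite negb_forall => /existsP[j]; rewrite negb_imply negbK => /andP[ijl /eqP fij].
  by rewrite (big_rem _ ijl) /= /xv !valK /= fij subrr mul0r mulr0.
exists f; split=> // i j ijl.
by have /forallP/(_ j) := fl i; rewrite ijl.
Qed.
End AlonTarsi.

Lemma graph_coef_choosable (l : seq (nat * nat)) (d : seq nat) (R : nat -> seq nat) :
  loopless (size d) l -> sumn d = size l ->
  (forall i, i < size d -> uniq (R i) && (nth 0 d i < size (R i))) ->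
  graph_coef l d != 0%R ->
  exists c : nat -> nat, (forall i, i < size d -> c i \in R i) /\
    forall i j, (i, j) \in l -> c i <> c j.
Proof.
move=> ll sd hR cf; set m := size d.
pose M := (\max_(i < m) \max_(x <- R i) x).+1.
have RM i x : i < m -> x \in R i -> x < M.
  move=> im xR; rewrite ltnS (leq_trans _ (leq_bigmax (Ordinal im))) //=.
  exact: leq_bigmax_seq.
(* The lists are cut to exactly [d_i + 1] colours, since the moments single out the exponent
   [#|A i| - 1]. *)
pose A (i : 'I_m) := [set a : 'I_M | val a \in take (nth 0 d i).+1 (R i)].
have [| |f [fA fl]] := @graph_coef_colourable m M A l d ll _ _ cf.
- by rewrite -sd sumnE (big_nth 0) big_mkord.
- move=> i; have /andP[uR szR] := hR i (ltn_ord i).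
  rewrite -[RHS](size_takel szR) cardE -(size_map val); apply: perm_size.
  apply: uniq_perm; rewrite ?take_uniq ?map_inj_uniq ?enum_uniq //; first exact: val_inj.
  move=> x; apply/mapP/idP => [[a + ->]|xR]; first by rewrite mem_enum inE.
  have xM : x < M by apply: RM (ltn_ord i) _; exact: mem_take xR.
  by exists (Ordinal xM); rewrite ?mem_enum ?inE.
pose c v := oapp (fun i : 'I_m => val (f i)) 0 (insub v).
exists c; split=> [i im|i j ijl].
  rewrite /c insubT /=; have := fA (Ordinal im); rewrite inE /=; exact: mem_take.
have /and3P[im jm _] := allP ll _ ijl.
rewrite /c !insubT /=; apply/eqP; exact: (fl (Ordinal im) (Ordinal jm)).
Qed.

(** * Galvin's theorem *)

Lemma count_split (T : Type) (a b : pred T) (s : seq T) :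
  count a s = count b (filter a s) + count (predC b) (filter a s).
Proof. by rewrite count_predC size_filter. Qed.

Section Galvin.
(* [p e] and [q e] are the ranks of the edge [e] at its ends [l e] and [r e];
   smaller ranks are preferred. *)
Variables (E : eqType) (l r p q : E -> nat).

Definition meet (e f : E) : bool := (l e == l f) || (r e == r f).

Definition better (h e : E) : bool :=
  ((l h == l e) && (p h < p e)) || ((r h == r e) && (q h < q e)).

Definition ranked (S : seq E) : Prop :=
  {in S &, forall e f, l e = l f -> p e = p f -> e = f} /\
  {in S &, forall e f, r e = r f -> q e = q f -> e = f}.

Lemma sub_ranked (S S' : seq E) : {subset S' <= S} -> ranked S -> ranked S'.
Proof.
by move=> sub [h1 h2]; split=> e f /sub eS /sub fS; [exact: h1|exact: h2].
Qed.

(** Deferred acceptance: every left end proposes its [best] edge, and a proposal that its right end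
    refuses ([bad]) is deleted. When nothing is refused, the best edges are the kernel. *)
Lemma stable_matching (S : seq E) : ranked S ->
  exists K : seq E, [/\ {subset K <= S},
    {in K &, forall e f, meet e f -> e = f} &
    {in S, forall e, e \notin K -> exists2 h, h \in K & better h e}].
Proof.
have [n] := ubnP (size S); elim: n S => // n IH S szS rkS.
pose best e := all (fun g => (l g == l e) ==> (p e <= p g)) S.
pose bad f := best f && has (fun e => [&& best e, r e == r f & q e < q f]) S.
have bestP e g : best e -> g \in S -> l g = l e -> p e <= p g.
  by move=> /allP h gS lg; have := h g gS; rewrite lg eqxx.
have [/hasP[f fS /andP[bf /hasP[e eS /and3P[be /eqP ref qef]]]]|nbad] := boolP (has bad S).
  pose S' := [seq g <- S | g != f].
  have sub : {subset S' <= S} by move=> g; rewrite mem_filter => /andP[].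
  have [||K [KS Kind Kabs]] := IH S'; last 1 first.
  - exists K; split=> [g /KS/sub //||g gS gK]; first exact: Kind.
    have [gf|gf] := eqVneq g f; last by apply: Kabs; rewrite ?mem_filter ?gf.
    (* The deleted [f] is dominated by [e], or by whatever dominates [e]: that edge beats [e] at the
       right end, because [e] is best at its left end. *)
    have eS' : e \in S'.
      by rewrite mem_filter eS andbT; apply: contraTneq qef => ->; rewrite ltnn.
    have [eK|eK] := boolP (e \in K).
      by exists e; rewrite // /better gf ref eqxx qef orbT.
    have [h hK] := Kabs e eS' eK; case/orP=> /andP[/eqP he lt].
      by rewrite ltnNge (bestP e h be (sub _ (KS _ hK)) he) in lt.
    by exists h => //; rewrite /better gf -ref he eqxx (ltn_trans lt qef) orbT.
  - rewrite -ltnS; apply: leq_trans szS; rewrite size_filter ltnS -(count_predC (pred1 f) S).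
    by rewrite -[ltnLHS]add0n ltn_add2r -has_count has_pred1.
  - exact: sub_ranked rkS.
have [rk1 rk2] := rkS; exists [seq e <- S | best e]; split=> [e||].
- by rewrite mem_filter => /andP[].
- move=> e f; rewrite !mem_filter => /andP[be eS] /andP[bf fS] /orP[/eqP lef|/eqP ref].
    apply: rk1 => //; apply/eqP; rewrite eqn_leq bestP //=.
    exact: bestP.
  apply: rk2 => //; case: (ltngtP (q e) (q f)) => // lt; case/negP: nbad; apply/hasP.
    exists f => //; rewrite /bad bf; apply/hasP; exists e => //.
    by rewrite be ref eqxx.
  exists e => //; rewrite /bad be; apply/hasP; exists f => //.
  by rewrite bf ref eqxx.
- move=> e eS; rewrite mem_filter eS andbT => nbe.
  have [h [hS bh le pe]] : exists h, [/\ h \in S, best h, l h = l e & p h < p e].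
    have [k] := ubnP (p e); elim: k e eS nbe => // k IHk e eS nbe pe.
    have /allPn[g gS] := nbe; rewrite negb_imply -ltnNge => /andP[/eqP lg pg].
    have [bg|nbg] := boolP (best g); first by exists g.
    have [|h [hS bh lh ph]] := IHk g gS nbg; first exact: leq_trans pg _.
    by exists h; split; rewrite // ?lh // (ltn_trans ph).
  by exists h; rewrite ?mem_filter ?bh // /better le eqxx pe.
Qed.

(** Give a colour [a] to a kernel of the edges whose lists contain [a]. Every other such edge loses
    the colour [a], but also at least one better edge, so the hypothesis survives for the uncoloured
    edges. *)
Lemma galvin (C : seq E) (R : E -> seq nat) : ranked C ->
  {in C, forall e, uniq (R e) &&
     (count (fun h => better h e) C < size (R e))} ->
  exists c : E -> nat, {in C, forall e, c e \in R e} /\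
    {in C &, forall e f, e != f -> meet e f -> c e <> c f}.
Proof.
have [n] := ubnP (size C); elim: n C R => // n IH [|e0 C0] R szC rkC hR.
  by exists (fun=> 0).
set C := e0 :: C0 in szC rkC hR *.
have e0C : e0 \in C by rewrite mem_head.
have /andP[_] := hR e0 e0C; case R0: (R e0) => [//|a R1] _.
pose S := [seq e <- C | a \in R e].
have SC : {subset S <= C} by move=> e; rewrite mem_filter => /andP[].
have [K [KS Kind Kabs]] := stable_matching (sub_ranked SC rkC).
have e0S : e0 \in S by rewrite mem_filter R0 mem_head.
have [h0 h0K] : exists h, h \in K.
  have [e0K|e0K] := boolP (e0 \in K); first by exists e0.
  by have [h hK _] := Kabs _ e0S e0K; exists h.
pose C' := [seq e <- C | e \notin K].
have C'C : {subset C' <= C} by move=> e; rewrite mem_filter => /andP[].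
have split_count (P : pred E) :
    count P C = count (mem K) (filter P C) + count P C'.
  rewrite (count_split P (mem K)) /C' !count_filter; congr (_ + _).
  by apply: eq_count => e /=; rewrite andbC.
have h0C : h0 \in C by apply/SC/KS.
have szC' : size C' < n.
  rewrite -ltnS; apply: leq_trans szC; rewrite ltnS -(count_predT C) split_count filter_predT.
  by rewrite -[ltnLHS]add0n count_predT ltn_add2r -has_count; apply/hasP; exists h0.
pose R' e := [seq x <- R e | x != a].
have [e eC'|c [cR cP]] := IH C' R' szC' (sub_ranked C'C rkC).
  have eC := C'C _ eC'; have /andP[ue he] := hR e eC.
  rewrite filter_uniq //=.
  have [aR|aR] := boolP (a \in R e); last first.
    rewrite (_ : R' e = R e); last first.
      by apply/all_filterP/allP => x xR; apply: contraNneq aR => <-.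
    by rewrite (leq_ltn_trans _ he) // split_count leq_addl.
  have eS : e \in S by rewrite mem_filter aR.
  have [|h hK hb] := Kabs e eS; first by move: eC'; rewrite mem_filter => /andP[].
  rewrite /R' -rem_filter // size_rem // -ltnS prednK; last by case: (R e) he.
  rewrite (leq_ltn_trans _ he) // split_count -add1n leq_add2r -has_count.
  by apply/hasP; exists h => //; rewrite mem_filter hb; apply/SC/KS.
exists (fun e => if e \in K then a else c e); split=> [e eC|e f eC fC ef mef].
  have [eK|eK] := boolP (e \in K).
    by have := KS e eK; rewrite mem_filter => /andP[].
  have /cR : e \in C' by rewrite mem_filter eK.
  by rewrite mem_filter => /andP[].
have nota g : g \in C -> g \notin K -> c g <> a.
  move=> gC gK; have /cR : g \in C' by rewrite mem_filter gK.
  by rewrite mem_filter => /andP[/eqP].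
have [eK|eK] := boolP (e \in K); have [fK|fK] := boolP (f \in K).
- by case/eqP: ef; exact: Kind.
- by move/esym; exact: nota.
- exact: nota.
- by apply: cP; rewrite ?mem_filter ?eK ?fK.
Qed.
End Galvin.

(** * Extending colourings to a configuration *)

Definition touches (v : nat) (e : nat * nat) : bool := (e.1 == v) || (e.2 == v).

Definition conflict (e f : nat * nat) : bool :=
  (e != f) && [|| e.1 == f.1, e.1 == f.2, e.2 == f.1 | e.2 == f.2].

Definition list_proper (C : seq (nat * nat)) (R : nat * nat -> seq nat)
    (c : nat * nat -> nat) : Prop :=
  {in C, forall e, c e \in R e} /\
  {in C &, forall e f, conflict e f -> c e <> c f}.

Definition big_lists (C : seq (nat * nat)) (R : nat * nat -> seq nat) (f : nat * nat -> nat) :=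
  {in C, forall e, uniq (R e) && (f e <= size (R e))}.

(** The new colouring need not agree with the given one on [C0]: [end_extendable] relies on
    recolouring these edges. *)
Definition extendable (C0 C : seq (nat * nat)) (f : nat * nat -> nat) : Prop :=
  forall R, big_lists C R f ->
    (exists c, list_proper C0 R c) -> exists c, list_proper C R c.

Definition choosable (C : seq (nat * nat)) (f : nat * nat -> nat) : Prop :=
  forall R, big_lists C R f -> exists c, list_proper C R c.

Definition deg (T : finType) (F : {set {set T}}) (v : T) : nat :=
  #|[set e in F | v \in e]|.

Definition colourable (T : finType) (F : {set {set T}}) (L : {set T} -> seq nat) : Prop :=
  exists c : {set T} -> nat, {in F, forall e, c e \in L e} /\
    {in F &, forall e f, adjacent_edges e f -> c e <> c f}.

Definition edges_choosable (T : finType) (F : {set {set T}}) (k : nat) : Prop :=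
  forall L : {set T} -> seq nat,
    {in F, forall e, uniq (L e) && (k <= size (L e))} -> colourable F L.

Definition well_formed (n : nat) (C : seq (nat * nat)) : bool :=
  uniq C && all (fun e => e.1 < e.2 < n) C.

Lemma size_filter_notin (A : eqType) (s t : seq A) :
  uniq s -> size s - size t <= size [seq x <- s | x \notin t].
Proof.
move=> us; rewrite size_filter leq_subLR -(count_predC [in t] s) leq_add2r.
rewrite -size_filter; apply: uniq_leq_size; first exact: filter_uniq.
by move=> x; rewrite mem_filter => /andP[].
Qed.

Section Extension.
Variables (T : finType) (n : nat) (phi : nat -> T) (C : seq (nat * nat)).
Hypotheses (phi_inj : {in gtn n &, injective phi}) (wfC : well_formed n C).

Definition img (e : nat * nat) : {set T} := [set phi e.1; phi e.2].

Lemma well_formedP e : e \in C -> [/\ e.1 < n, e.2 < n & e.1 < e.2].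
Proof.
move: wfC => /andP[_ /allP h] /h /andP[h1 h2]; split=> //.
exact: ltn_trans h2.
Qed.

Lemma mem_img u e : u < n -> e \in C -> (phi u \in img e) = touches u e.
Proof.
move=> un /well_formedP[e1 e2 _]; rewrite !inE /touches.
by rewrite !(inj_in_eq phi_inj) // ![u == _]eq_sym.
Qed.

Lemma img_inj : {in C &, injective img}.
Proof.
move=> e f eC fC ef.
have [e1 e2 e12] := well_formedP eC; have [f1 f2 f12] := well_formedP fC.
have := mem_img e1 fC; rewrite -ef mem_img // /touches eqxx /= => /esym.
have := mem_img e2 fC; rewrite -ef mem_img // /touches eqxx orbT => /esym.
case: e f {eC fC ef} e1 e2 e12 f1 f2 f12 => [a b] [c d] /= *; congr pair; lia.
Qed.

Lemma adjacent_img e f : e \in C -> f \in C ->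
  adjacent_edges (img e) (img f) = conflict e f.
Proof.
move=> eC fC; rewrite /adjacent_edges (inj_in_eq img_inj) // /conflict.
congr (_ && _).
have [e1 e2 _] := well_formedP eC; have [f1 f2 _] := well_formedP fC.
apply/set0Pn/idP => [[x]|].
  rewrite in_setI => /andP[/set2P[]-> h].
    by move: h; rewrite mem_img // /touches ![_ == e.1]eq_sym => /orP[]->; rewrite ?orbT.
  by move: h; rewrite mem_img // /touches ![_ == e.2]eq_sym => /orP[]->; rewrite ?orbT.
case/or4P => /eqP h.
- by exists (phi e.1); rewrite !inE h !eqxx.
- by exists (phi e.1); rewrite !inE h !eqxx ?orbT.
- by exists (phi e.2); rewrite !inE h !eqxx ?orbT.
- by exists (phi e.2); rewrite !inE h !eqxx ?orbT.
Qed.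

Variables (F : {set {set T}}) (k : nat) (C0 : seq (nat * nat)) (f : nat * nat -> nat).
Hypotheses (CF : {in C, forall e, img e \in F}) (C0C : {subset C0 <= C}).

Definition outer : {set {set T}} := [set g in F | g \notin map img C].

Lemma deg_outer u : u < n ->
  deg F (phi u) = deg outer (phi u) + count (touches u) C.
Proof.
move=> un; rewrite /deg -(cardsID [set g in map img C] [set g in F | phi u \in g]) addnC.
congr (_ + _).
  by apply: eq_card => g; rewrite !inE; case: (g \in F); rewrite ?andbF ?andbT //=.
have -> : [set g in F | phi u \in g] :&: [set g in map img C]
    = [set g in map img (filter (touches u) C)].
  apply/setP => g; rewrite !inE; apply/andP/mapP => [[/andP[gF ug] /mapP[e eC ge]]|[e]].
    by exists e; rewrite // mem_filter eC -mem_img // -ge ug.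
  rewrite mem_filter => /andP[ue eC] ->; rewrite CF // mem_img // ue.
  by rewrite map_f.
rewrite -size_filter -(size_map img) cardsE; apply/card_uniqP.
rewrite map_inj_in_uniq ?filter_uniq //; first by case/andP: wfC.
by move=> e f'; rewrite !mem_filter => /andP[_ eC] /andP[_ fC]; exact: img_inj.
Qed.

Hypothesis fk : {in C, forall e,
  f e + (deg F (phi e.1) - count (touches e.1) C)
      + (deg F (phi e.2) - count (touches e.2) C) <= k}.

(** Only the colours of outer edges are kept. An edge of [C] loses at most one colour for each outer
    edge at its ends, so [fk] leaves [f e] colours; the old colours on [C0] survive in the reduced
    lists and serve as the premise of [extendable]. *)
Lemma extend_colouring (L : {set T} -> seq nat) :
  {in F, forall e, uniq (L e) && (k <= size (L e))} ->
  extendable C0 C f ->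
  colourable [set g in F | g \notin [seq img e | e <- C & e \notin C0]] L ->
  colourable F L.
Proof.
move=> hL hext [c [cL cP]].
pose F0 := outer.
pose R e := [seq x <- L (img e) |
  x \notin [seq c g | g : {set T} <- enum F0 & (phi e.1 \in g) || (phi e.2 \in g)]].
have F0sub g : g \in F0 -> g \in [set g in F | g \notin [seq img e | e <- C & e \notin C0]].
  rewrite !inE => /andP[-> /=]; apply: contra => /mapP[e]; rewrite mem_filter => /andP[_ eC] ->.
  exact: map_f.
have C0sub e : e \in C0 -> img e \in [set g in F | g \notin [seq img e | e <- C & e \notin C0]].
  move=> eC0; rewrite inE CF ?C0C //=; apply/mapP => -[e']; rewrite mem_filter => /andP[e'0 e'C].
  by move/img_inj; rewrite C0C // => /(_ isT e'C) ee'; rewrite -ee' eC0 in e'0.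
have adjF0 e g : e \in C -> g \in F0 -> adjacent_edges (img e) g =
    (phi e.1 \in g) || (phi e.2 \in g).
  move=> eC gF0; rewrite /adjacent_edges.
  have -> : img e != g.
    by apply: contraTneq gF0 => <-; rewrite inE map_f ?andbF.
  apply/set0Pn/orP => [[x]|[h|h]].
  - by rewrite in_setI => /andP[/set2P[]->]; [left|right].
  - by exists (phi e.1); rewrite !inE eqxx.
  - by exists (phi e.2); rewrite !inE eqxx orbT.
have hR : big_lists C R f.
  move=> e eC; have /andP[uL szL] := hL _ (CF eC); rewrite filter_uniq //=.
  apply: leq_trans (size_filter_notin _ uL).
  have [e1 e2 _] := well_formedP eC.
  have := fk eC; rewrite !deg_outer // !addnK.
  set N := size (map _ _); suff : N <= deg outer (phi e.1) + deg outer (phi e.2).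
    move: szL; set a := size (L _); clearbody N a; clear.
    by move: (f e) (deg outer (phi e.1)) (deg outer (phi e.2)) => x y z; lia.
  rewrite /N size_map /deg -cardsUI.
  apply: leq_trans (leq_addr _ _); rewrite -(card_uniqP _); last exact/filter_uniq/enum_uniq.
  apply/subset_leq_card/subsetP => g; rewrite mem_filter mem_enum !inE.
  by case/andP => h ->.
have [|c' [c'R c'P]] := hext R hR.
  exists (fun e => c (img e)); split=> [e eC0|e e' eC0 e'C0 ee'].
    rewrite mem_filter cL ?C0sub // andbT; apply/mapP => -[g].
    rewrite mem_filter mem_enum => /andP[h gF0]; apply: cP; rewrite ?C0sub ?F0sub //.
    by rewrite adjF0 // C0C.
  by apply: cP; rewrite ?C0sub // adjacent_img ?C0C.
pose pre g := nth (0, 0) C (index g (map img C)).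
have preK e : e \in C -> pre (img e) = e.
  move=> eC; have ic : index (img e) (map img C) < size C.
    by rewrite -(size_map img) index_mem map_f.
  apply: img_inj; rewrite ?mem_nth // /pre -(nth_map (0, 0) (img e)) //.
  by rewrite nth_index ?map_f.
have F0P g : g \in F -> g \notin map img C -> g \in F0 by rewrite !inE => -> ->.
exists (fun g => if g \in map img C then c' (pre g) else c g).
have cross e g : e \in C -> g \in F0 -> adjacent_edges (img e) g -> c' e <> c g.
  move=> eC gF0 ad h; have := c'R e eC; rewrite mem_filter => /andP[/mapP[]].
  by exists g; rewrite // mem_filter mem_enum gF0 -adjF0 // ad.
split=> [g gF|g h gF hF ad].
  have [/mapP[e eC ->]|gC] := boolP (g \in map img C).
    by rewrite preK //; have := c'R e eC; rewrite mem_filter => /andP[].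
  by apply/cL/F0sub/F0P.
have [/mapP[e eC ge]|gC] := boolP (g \in map img C);
  have [/mapP[e' e'C he']|hC] := boolP (h \in map img C).
- rewrite ge he' !preK //; apply: c'P; rewrite // -adjacent_img // -ge -he' //.
- by rewrite ge preK //; apply: cross; rewrite ?F0P // -ge.
- rewrite he' preK //; apply/nesym/cross; rewrite ?F0P // -he'.
  by move: ad; rewrite /adjacent_edges eq_sym setIC.
- by apply: cP; rewrite ?F0sub ?F0P.
Qed.
End Extension.

(** * Checkable certificates for choosability, and the reducible sets of leaves *)

Definition line_graph (C : seq (nat * nat)) : seq (nat * nat) :=
  [seq ij <- [seq (i, j) | i <- iota 0 (size C), j <- iota 0 (size C)] |
    (ij.1 < ij.2) && conflict (nth (0, 0) C ij.1) (nth (0, 0) C ij.2)].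

Definition alon_tarsi_cert (C : seq (nat * nat)) (f : nat * nat -> nat) (d : seq nat) : bool :=
  [&& uniq C, size d == size C, sumn d == size (line_graph C),
      all (fun i => nth 0 d i < f (nth (0, 0) C i)) (iota 0 (size C)) &
      graph_coef (line_graph C) d != 0%R].

Lemma conflict_sym : symmetric conflict.
Proof.
move=> e f; rewrite /conflict eq_sym ![_ == f.1]eq_sym ![_ == f.2]eq_sym.
by congr (_ && (_ || _)); rewrite orbCA.
Qed.

Lemma alon_tarsi_choosable C f d : alon_tarsi_cert C f d -> choosable C f.
Proof.
move=> /and5P[uC /eqP szd /eqP sd /allP hf cf] R hR.
have mem_line i j : ((i, j) \in line_graph C) =
    [&& i < j, j < size C & conflict (nth (0, 0) C i) (nth (0, 0) C j)].
  rewrite mem_filter /= [RHS]andbCA andbC [(j < _) && _]andbC -!andbA.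
  rewrite [RHS]andbCA.
  have -> : ((i, j) \in [seq (i, j) | i <- iota 0 (size C), j <- iota 0 (size C)])
     = (i < size C) && (j < size C).
    apply/allpairsP/andP => [[[a b] /= [ha hb [-> ->]]]|[ic jc]].
      by rewrite !mem_iota in ha hb.
    by exists (i, j); rewrite !mem_iota.
  by have [ij|] := ltnP i j; rewrite ?andbF //; have [jC|] := ltnP j (size C);
    rewrite ?andbF ?andbT ?(ltn_trans ij jC) //=.
have [||c [cR cl]] := @graph_coef_choosable (line_graph C) d
    (fun i => R (nth (0, 0) C i)) _ sd _ cf.
- apply/allP => -[i j]; rewrite mem_line szd => /and3P[ij jC _] /=.
  by rewrite jC (ltn_trans ij jC) neq_ltn ij.
- move=> i; rewrite szd => iC; have /andP[-> h] := hR _ (mem_nth (0, 0) iC).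
  by rewrite (leq_trans _ h) // hf ?mem_iota.
exists (fun e => c (index e C)); split=> [e eC|e e' eC e'C ee'].
  by have := cR (index e C); rewrite szd index_mem nth_index // => /(_ eC).
have [lt|lt|eq] := ltngtP (index e C) (index e' C).
- by apply: cl; rewrite mem_line lt index_mem e'C !nth_index.
- by apply/nesym/cl; rewrite mem_line lt index_mem eC !nth_index // conflict_sym.
- by move: ee'; rewrite /conflict -(nth_index (0, 0) eC) eq nth_index // eqxx.
Qed.

Definition rank_of (l : seq ((nat * nat) * (nat * nat))) (e : nat * nat) : nat * nat :=
  (nth ((0, 0), (0, 0)) l (index e (map fst l))).2.

(** The conditions [e.1 != g.2] and [e.2 != g.1] make first and second ends the two sides of a
    bipartite graph. Ranks at a common end are distinct, so at most [p e + q e] edges are better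
    than [e]. *)
Definition galvin_cert (C : seq (nat * nat)) (f : nat * nat -> nat)
    (l : seq ((nat * nat) * (nat * nat))) : bool :=
  let p e := (rank_of l e).1 in let q e := (rank_of l e).2 in
  [&& uniq C, all (fun e => p e + q e < f e) C &
      all (fun e => all (fun g => (e == g) || [&& e.1 != g.2, e.2 != g.1,
            (e.1 == g.1) ==> (p e != p g) & (e.2 == g.2) ==> (q e != q g)]) C) C].

Lemma count_lower (A : eqType) (s : seq A) (P : pred A) (p : A -> nat) (b : nat) :
  uniq s -> {in s &, forall x y, P x -> P y -> p x = p y -> x = y} ->
  count (fun x => P x && (p x < b)) s <= b.
Proof.
move=> us inj; rewrite -size_filter -(size_map p) -[leqRHS](size_iota 0).
apply: uniq_leq_size.
  rewrite map_inj_in_uniq ?filter_uniq // => x y; rewrite !mem_filter.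
  by move=> /andP[/andP[Px _] xs] /andP[/andP[Py _] ys]; exact: inj.
by move=> _ /mapP[x + ->]; rewrite mem_filter mem_iota => /andP[/andP[_ ->]].
Qed.

Lemma galvin_choosable C f l : galvin_cert C f l -> choosable C f.
Proof.
move=> /and3P[uC /allP hf /allP hl] R hR.
set p := fun e => (rank_of l e).1 in hf hl; set q := fun e => (rank_of l e).2 in hf hl.
have hC e g : e \in C -> g \in C -> e != g -> [&& e.1 != g.2, e.2 != g.1,
            (e.1 == g.1) ==> (p e != p g) & (e.2 == g.2) ==> (q e != q g)].
  by move=> eC gC /negbTE eg; have /allP/(_ g gC) := hl e eC; rewrite eg.
have rk : ranked fst snd p q C.
  split=> e g eC gC h1 h2; apply/eqP; apply: contraT => /(hC _ _ eC gC).
    by case/and4P=> _ _; rewrite h1 h2 !eqxx.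
  by case/and4P=> _ _ _; rewrite h1 h2 !eqxx.
have [|c [cR cC]] := @galvin _ fst snd p q C R rk.
  move=> e eC; have /andP[-> fe] := hR e eC; apply: leq_trans fe.
  apply: leq_ltn_trans (hf e eC); rewrite /better.
  pose a := fun h : nat * nat => (h.1 == e.1) && (p h < p e).
  pose b := fun h : nat * nat => (h.2 == e.2) && (q h < q e).
  apply: leq_trans (leq_addr (count (predI a b) C) _) _.
  rewrite (count_predUI a b C) leq_add // count_lower // => x y xC yC /eqP x1 /eqP y1 xy;
    apply/eqP; apply: contraT => /(hC _ _ xC yC) /and4P[_ _].
    by rewrite x1 y1 xy !eqxx.
  by move=> _; rewrite x1 y1 xy !eqxx.
exists c; split=> // e g eC gC /andP[eg sh]; apply: cC => //.
by have /and4P[h1 h2 _ _] := hC e g eC gC eg; move: sh; rewrite (negbTE h1) (negbTE h2) /=.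
Qed.

(* Centres are numbered 0 to 3 and leaves from 4 on; leaf [4 + i] is joined to
   centre 0 and to the centres in [nth [::] ts i]. In the application centre 0
   has degree at most [k - slack]. *)
Definition leaf_edges (ts : seq (seq nat)) : seq (nat * nat) :=
  flatten [seq [seq (c, 4 + i) | c <- 0 :: nth [::] ts i] | i <- iota 0 (size ts)].

(** All edges at a leaf are uncoloured, so only coloured edges at the centre [e.1] cost colours. A
    centre of degree at most [k] leaves as many colours as it has uncoloured edges. *)
Definition leaf_bound (slack : nat) (ts : seq (seq nat)) (e : nat * nat) : nat :=
  count (touches e.1) (leaf_edges ts) + (if e.1 == 0 then slack else 0).

Definition leaf_types : seq (seq nat) :=
  [:: [:: 1]; [:: 2]; [:: 3]; [:: 1; 2]; [:: 1; 3]; [:: 2; 3]].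

(* Slack at centre 0, leaf types, and, for each edge of [leaf_edges], its
   position in the preference orders of its centre and of its leaf. *)
Definition base_leaf_certs : seq (nat * seq (seq nat) * seq (nat * nat)) :=
  [:: (0, [:: [:: 1]; [:: 1]],
       [:: (0, 1); (1, 0); (1, 0); (0, 1)]);
      (0, [:: [:: 1]; [:: 1; 2]; [:: 1; 2]],
       [:: (1, 1); (2, 0); (0, 2); (1, 1); (1, 0); (2, 0); (0, 2); (0, 1)]);
      (0, [:: [:: 1]; [:: 1; 2]; [:: 2]],
       [:: (1, 1); (1, 0); (0, 2); (0, 1); (1, 0); (2, 0); (0, 1)]);
      (0, [:: [:: 1; 2]; [:: 1; 2]; [:: 1; 2]],
       [:: (0, 2); (1, 1); (2, 0); (1, 1); (2, 0); (0, 2); (2, 0); (0, 2); (1, 1)]);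
      (0, [:: [:: 1]; [:: 1; 2]; [:: 1; 3]; [:: 2; 3]],
       [:: (2, 1); (2, 0); (0, 2); (1, 1); (1, 0); (3, 0); (0, 2); (0, 1); (1, 2); (0, 1); (1, 0)]);
      (0, [:: [:: 1]; [:: 1; 2]; [:: 2; 3]; [:: 2; 3]],
       [:: (2, 1); (1, 0); (0, 2); (0, 1); (2, 0); (1, 2); (1, 1); (1, 0); (3, 0); (0, 2); (0, 1)]);
      (0, [:: [:: 1]; [:: 1; 2]; [:: 2; 3]; [:: 3]],
       [:: (2, 1); (1, 0); (0, 2); (0, 1); (1, 0); (1, 2); (0, 1); (1, 0); (3, 0); (0, 1)]);
      (0, [:: [:: 1; 2]; [:: 1; 2]; [:: 1; 3]; [:: 1; 3]],
       [:: (0, 2); (2, 1); (1, 0); (1, 2); (3, 0); (0, 1); (2, 1); (0, 2); (1, 0); (3, 0); (1, 2); (0, 1)]);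
      (0, [:: [:: 1; 2]; [:: 1; 2]; [:: 1; 3]; [:: 2; 3]],
       [:: (0, 2); (1, 1); (2, 0); (1, 2); (2, 0); (1, 1); (2, 1); (0, 2); (1, 0); (3, 0); (0, 2); (0, 1)]);
      (1, [:: [:: 1; 2]; [:: 1; 2]; [:: 1; 2]],
       [:: (0, 2); (0, 1); (1, 0); (1, 2); (1, 1); (2, 0); (2, 1); (2, 0); (0, 2)]);
      (1, [:: [:: 1; 2]; [:: 1; 2]; [:: 1; 3]],
       [:: (0, 2); (1, 1); (1, 0); (1, 2); (2, 0); (0, 1); (2, 1); (0, 2); (0, 0)])].

(** Filtering [[:: 1; 2; 3]] puts the relabelled type back in increasing order, so that types can be
    compared by equality. *)
Definition relabel (s : seq nat) (t : seq nat) : seq nat :=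
  [seq c <- [:: 1; 2; 3] | c \in [seq nth 0 (0 :: s) x | x <- t]].

Definition leaf_certs : seq (nat * seq (seq nat) * seq ((nat * nat) * (nat * nat))) :=
  [seq (x.1.1, [seq relabel s t | t <- x.1.2],
        zip [seq (nth 0 (0 :: s) e.1, e.2) | e <- leaf_edges x.1.2] x.2) |
    x <- base_leaf_certs, s <- permutations [:: 1; 2; 3]].

Definition covers (slack : nat) (ts : seq (seq nat)) : bool :=
  has (fun x => (x.1.1 == slack) &&
    all (fun t => count_mem t x.1.2 <= count_mem t ts) leaf_types) leaf_certs.

Lemma leaf_certs_valid :
  all (fun x => [&& galvin_cert (leaf_edges x.1.2) (leaf_bound x.1.1 x.1.2) x.2,
                    well_formed (4 + size x.1.2) (leaf_edges x.1.2),
                    all (fun i => count (touches (4 + i)) (leaf_edges x.1.2)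
                                  == (size (nth [::] x.1.2 i)).+1) (iota 0 (size x.1.2)),
                    x.1.2 != [::] & all [in leaf_types] x.1.2]) leaf_certs.
Proof. by vm_compute. Qed.

Lemma covers_four :
  all (fun a => all (fun b => all (fun c => all (fun d => covers 0 [:: a; b; c; d])
    leaf_types) leaf_types) leaf_types) leaf_types.
Proof. by vm_compute. Qed.

(** [drop 3 leaf_types] lists the leaves of degree 3. Three distinct types are the exception treated
    by [hexagon_choosable]. *)
Lemma covers_three :
  let t := drop 3 leaf_types in
  all (fun a => all (fun b => all (fun c =>
    uniq [:: a; b; c] || covers 1 [:: a; b; c]) t) t) t.
Proof. by vm_compute. Qed.

Lemma coversP slack ts : covers slack ts ->
  exists P, [/\ choosable (leaf_edges P) (leaf_bound slack P),
    well_formed (4 + size P) (leaf_edges P),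
    forall i, i < size P ->
      count (touches (4 + i)) (leaf_edges P) = (size (nth [::] P i)).+1,
    P != [::] & forall t, count_mem t P <= count_mem t ts].
Proof.
move=> /hasP[[[k P] l] xin /andP[/eqP <- /allP h]].
have /allP/(_ _ xin)/and5P[cert wf /allP cnt P0 /allP sub] := leaf_certs_valid.
exists P; split=> // [|i iP|t]; first exact: galvin_choosable cert.
  by apply/eqP/cnt; rewrite mem_iota.
have [/h //|tn] := boolP (t \in leaf_types).
rewrite (count_memPn _) //; apply: contra tn; exact: sub.
Qed.

Lemma pick_by_type (A B : eqType) (tau : A -> B) (P : seq B) (ws : seq A) : uniq ws ->
  (forall t, count_mem t P <= count_mem t (map tau ws)) ->
  exists ws', [/\ uniq ws', {subset ws' <= ws} & map tau ws' = P].
Proof.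
elim: P ws => [|t P IH] ws uws h; first by exists [::].
have /mapP[w win tw] : t \in map tau ws.
  by rewrite -has_pred1 has_count; apply: leq_trans (h t); rewrite /= eqxx.
have pw := perm_to_rem win.
have [|t'|ws' [uws' sub eq]] := IH (rem w ws); first exact: rem_uniq.
  have := h t'; rewrite (permP (perm_map tau pw) (pred1 t')) /= -tw.
  by rewrite leq_add2l.
exists (w :: ws'); split=> [|x|]; last by rewrite /= eq tw.
  rewrite /= uws' andbT; apply/negP => /sub; by rewrite mem_rem_uniqF.
by rewrite inE => /predU1P[->//|/sub /mem_rem].
Qed.

(** A wheel with hub 0 and rim 1-4-2-6-3-5, where 4, 5, 6 are the leaves. *)
Definition hexagon_edges : seq (nat * nat) :=
  [:: (0, 1); (0, 2); (0, 3); (1, 4); (1, 5); (2, 4); (2, 6); (3, 5); (3, 6);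
      (0, 4); (0, 5); (0, 6)].

(** Here [k = 7]. Hub (of degree 6) and leaves have no coloured edge, so the edges between them keep
    all 7 colours. Every other edge meets exactly one of 1, 2, 3, where at most [7 - 3] edges are
    coloured. *)
Definition hexagon_bound (e : nat * nat) : nat := if (e.1 == 0) && (3 < e.2) then 7 else 3.

Lemma hexagon_choosable : choosable hexagon_edges hexagon_bound.
Proof.
by apply: (@alon_tarsi_choosable _ _ [:: 0; 2; 2; 2; 2; 2; 2; 2; 2; 6; 6; 5]); vm_compute.
Qed.

(** * Subgraphs of 3-trees of maximum degree at most k, for k at least 7 *)

Section Neighbours.
Variable T : finType.
Implicit Types (V K N W B : {set T}) (E F : {set {set T}}) (u v w q : T).

Definition nb F v : {set T} := [set u | [set u; v] \in F].

Lemma nb_sym F u v : (u \in nb F v) = (v \in nb F u).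
Proof. by rewrite !inE setUC. Qed.

Lemma card_pair V E e : E \subset pairs V -> e \in E -> #|e| = 2.
Proof. by move=> /subsetP h /h; rewrite inE => /andP[_ /eqP]. Qed.

Lemma pair_mem V E u v : E \subset pairs V -> [set u; v] \in E ->
  [/\ u \in V, v \in V & u != v].
Proof.
move=> EV uvE; have := card_pair EV uvE; rewrite cards2.
move: (subsetP EV _ uvE); rewrite inE subUset !sub1set => /andP[/andP[-> ->] _].
by case: (u =P v).
Qed.

Lemma deg_nb V F v : F \subset pairs V -> deg F v = #|nb F v|.
Proof.
move=> FV; rewrite /deg -(card_in_imset (f := fun u => [set u; v])); last first.
  move=> a b; rewrite !inE => aF bF eqs.
  have [_ _ av] := pair_mem FV aF.
  have : a \in [set b; v] by rewrite -eqs set21.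
  by rewrite !inE (negbTE av) orbF => /eqP.
apply: eq_card => e; rewrite inE; apply/andP/imsetP => [[eF ve]|[u]].
  have /cards2P[x [y [xy exy]]] : #|e| == 2 by rewrite (card_pair FV eF).
  subst e; move: ve; rewrite !inE => /orP[]/eqP ->.
    by exists y; rewrite 1?setUC // inE setUC.
  by exists x; rewrite // inE.
by rewrite inE => uF ->; rewrite set22.
Qed.

Lemma three_tree_pairs V E : three_tree_on V E -> E \subset pairs V.
Proof.
elim=> [//|{}V {}E K v _ IH vV KV _ _].
rewrite subUset; apply/andP; split.
  apply: subset_trans IH _; apply/subsetP => e; rewrite !inE => /andP[h ->].
  by rewrite (subset_trans h) // subsetUr.
apply/subsetP => _ /imsetP[u uK ->]; rewrite inE cards2.
have uV := subsetP KV _ uK.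
have -> : u != v by apply: contraNneq vV => <-.
by rewrite subUset !sub1set !inE eqxx uV orbT.
Qed.

Lemma nb_add V E K q u v : E \subset pairs V -> q \notin V ->
  (u \in nb (E :|: [set [set u; q] | u in K]) v) =
  [|| u \in nb E v, (v == q) && (u \in K) | (u == q) && (v \in K)].
Proof.
move=> EV qV; rewrite inE in_setU [in RHS]inE; congr (_ || _).
apply/imsetP/orP => [[a aK eqs]|[]/andP[/eqP-> h]]; first last.
- by exists v; rewrite // setUC.
- by exists u.
have : q \in [set u; v] by rewrite eqs set22.
have ain : a \in [set u; v] by rewrite eqs set21.
rewrite !inE => /orP[]/eqP h; [right|left]; rewrite h eqxx /=.
  have : v \in [set a; q] by rewrite -eqs set22.
  rewrite !inE => /orP[/eqP->//|/eqP vq].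
  by move: ain; rewrite vq h !inE orbb => /eqP <-.
have : u \in [set a; q] by rewrite -eqs set21.
rewrite !inE => /orP[/eqP->//|/eqP uq].
by move: ain; rewrite uq h !inE orbb => /eqP <-.
Qed.

(* [v] is the last vertex of [B] in a construction order; [N] is a triangle
   containing its earlier neighbours, and [W] its later neighbours. *)
Lemma three_tree_last V E B : three_tree_on V E -> B :&: V != set0 ->
  exists v N W, [/\ v \in B, v \notin N, #|N| = 3, nb E v \subset N :|: W &
    W \subset V :\: B /\ forall w, w \in W ->
      (nb E w :&: B \subset v |: N) /\ #|nb E w :&: B| <= 3].
Proof.
elim=> [{}V cV|{}V {}E K q tE IH qV KV cK KE].
  move=> /set0Pn[v]; rewrite inE => /andP[vB vV].
  exists v, (V :\ v), set0; split; rewrite ?setD11 ?setU0 //.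
  - by have := cardsD1 v V; rewrite vV cV => -[].
  - apply/subsetP => u; rewrite inE => h.
    by have [uV _ uv] := pair_mem (subxx _) h; rewrite !inE uv uV.
  - by split=> [|w]; rewrite ?sub0set // inE.
have EV := three_tree_pairs tE.
have nbE := nb_add K _ _ EV qV.
have nbqE u : u \in nb E q = false.
  by apply: contraNF qV; rewrite inE => /(pair_mem EV)[].
have nbEq u : q \in nb E u = false by rewrite nb_sym nbqE.
have [qB _|qB] := boolP (q \in B).
  exists q, K, set0; split; rewrite ?setU0 //.
  - by apply: contra qV => /(subsetP KV).
  - apply/subsetP => u; rewrite nbE nbqE eqxx /= => /orP[//|/andP[_]].
    by move=> /(subsetP KV) qV'; rewrite qV' in qV.
  - by split=> [|w]; rewrite ?sub0set // inE.
move=> /set0Pn[b]; rewrite !inE => /andP[bB /predU1P[bq|bV]].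
  by rewrite bq (negbTE qB) in bB.
have [|v [N [W [vB vN cN nbv [WV hW]]]]] := IH.
  by apply/set0Pn; exists b; rewrite inE bB.
have vq : v != q by apply: contraNneq qB => <-.
have old w : w \in W -> nb (E :|: [set [set u; q] | u in K]) w :&: B = nb E w :&: B.
  move=> wW; apply/setP => u; rewrite !in_setI nbE.
  have [uB|] := boolP (u \in B); rewrite ?andbF ?andbT //.
  have /negbTE-> : w != q.
    by apply: contraNneq qV => <-; have := subsetP WV _ wW; rewrite inE => /andP[].
  have /negbTE-> : u != q by apply: contraNneq qB => <-.
  by rewrite !orbF.
have WV' : W \subset (q |: V) :\: B.
  by apply: subset_trans WV _; rewrite setSD // subsetUr.
have [vK|vK] := boolP (v \in K); last first.
  exists v, N, W; split=> //.
    apply/subsetP => u; rewrite nbE (negbTE vq) (negbTE vK) /= andbF orbF.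
    exact: subsetP.
  by split=> // w wW; rewrite old //; exact: hW.
exists v, N, (q |: W); split=> //.
  apply/subsetP => u; rewrite nbE (negbTE vq) /= => /orP[/(subsetP nbv)|/andP[/eqP -> _]].
    by rewrite !inE => /orP[]->; rewrite ?orbT.
  by rewrite !inE eqxx orbT.
split=> [|w]; first by rewrite subUset WV' sub1set !inE eqxx qB.
rewrite in_setU1 => /predU1P[->|wW]; last by rewrite old //; exact: hW.
have sub : nb (E :|: [set [set u; q] | u in K]) q \subset K.
  apply/subsetP => u; rewrite nbE nbqE eqxx /= => /orP[//|/andP[_]].
  by move=> /(subsetP KV) qV'; rewrite qV' in qV.
split; last by rewrite -cK subset_leq_card // subIset // sub.
(* [K] is a clique containing [v], so its other vertices are neighbours of [v]; those in [B] are not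
   in [W], hence lie in [N]. *)
apply/subsetP => u; rewrite inE => /andP[/(subsetP sub) uK uB].
rewrite in_setU1; have [//|uv] := eqVneq u v; rewrite /=.
have : u \in nb E v.
  by rewrite inE; apply: (subsetP KE); rewrite inE subUset !sub1set uK vK cards2 uv.
move=> /(subsetP nbv); rewrite inE => /orP[//|/(subsetP WV)].
by rewrite inE uB.
Qed.

End Neighbours.

(** * Reducible configurations around a vertex of large degree *)

Section BigDegree.
Variable T : finType.
Implicit Types (V K N W B : {set T}) (E F : {set {set T}}) (u v w q : T).

Lemma colourable_config n (phi : nat -> T) C F k f (L : {set T} -> seq nat) :
  {in gtn n &, injective phi} -> well_formed n C ->
  {in C, forall e, img phi e \in F} ->
  {in C, forall e, f e + (deg F (phi e.1) - count (touches e.1) C)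
                       + (deg F (phi e.2) - count (touches e.2) C) <= k} ->
  {in F, forall e, uniq (L e) && (k <= size (L e))} ->
  choosable C f -> C != [::] ->
  (forall F', F' \subset F -> #|F'| < #|F| -> colourable F' L) ->
  colourable F L.
Proof.
move=> inj wf CF fk hL ch C0 IH.
apply: (extend_colouring (C0 := [::]) inj wf CF _ fk hL) => [//|R hR _|].
  exact: ch.
apply: IH.
  by apply/subsetP => e; rewrite inE => /andP[].
apply/proper_card/properP; split.
  by apply/subsetP => e; rewrite inE => /andP[].
case: C C0 {wf fk ch} CF => // e C _ CF.
exists (img phi e); first by rewrite CF ?mem_head.
by rewrite inE CF ?mem_head //= negbK map_f // mem_filter /= mem_head.
Qed.

Lemma count_touches_deg n (phi : nat -> T) C F i :
  {in gtn n &, injective phi} -> well_formed n C ->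
  {in C, forall e, img phi e \in F} -> i < n ->
  count (touches i) C <= deg F (phi i).
Proof. by move=> inj wf CF i_n; rewrite (deg_outer inj wf CF i_n) leq_addl. Qed.

Lemma nth_uniq_inj (x0 : T) (s : seq T) : uniq s -> {in gtn (size s) &, injective (nth x0 s)}.
Proof. by move=> us i j hi hj /eqP; rewrite nth_uniq // => /eqP. Qed.

(** The edge meets at most [k - 1] others, so it can be coloured last. *)
Lemma colourable_light_edge F k a b (L : {set T} -> seq nat) :
  a != b -> [set a; b] \in F -> deg F a + deg F b <= k.+1 ->
  {in F, forall e, uniq (L e) && (k <= size (L e))} ->
  (forall F', F' \subset F -> #|F'| < #|F| -> colourable F' L) ->
  colourable F L.
Proof.
move=> ab abF dab hL.
have da : 0 < deg F a by apply/card_gt0P; exists [set a; b]; rewrite inE abF set21.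
have db : 0 < deg F b by apply/card_gt0P; exists [set a; b]; rewrite inE abF set22.
apply: (@colourable_config 2 (nth a [:: a; b]) [:: (0, 1)] F k (fun=> 1)) => //.
- by apply: (@nth_uniq_inj a [:: a; b]); rewrite /= inE ab.
- by move=> e; rewrite inE => /eqP ->.
- by move=> e; rewrite inE => /eqP -> /=; lia.
- by apply: (@alon_tarsi_choosable _ _ [:: 0]).
Qed.

Lemma mem_leaf_edges P e : e \in leaf_edges P ->
  exists c i, [/\ e = (c, 4 + i), i < size P & c \in 0 :: nth [::] P i].
Proof.
move=> /flatten_mapP[i iP /mapP[c cin ->]].
by exists c, i; rewrite mem_iota in iP.
Qed.

(* The edges at [ws] are uncoloured: counting the coloured neighbours of each of
   them leaves lists of size [leaf_bound slack P]. *)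
Lemma colourable_leaves F k slack v (N ws : seq T) P (L : {set T} -> seq nat) :
  uniq (v :: N ++ ws) -> size N = 3 ->
  choosable (leaf_edges P) (leaf_bound slack P) -> well_formed (4 + size P) (leaf_edges P) ->
  (forall i, i < size P ->
      count (touches (4 + i)) (leaf_edges P) = (size (nth [::] P i)).+1) ->
  P != [::] ->
  (forall u, deg F u <= k) -> deg F v + slack <= k ->
  {in ws, forall w, v \in nb F w /\ deg F w =
     (size [seq c <- [:: 1; 2; 3] | nth v (v :: N) c \in nb F w]).+1} ->
  [seq [seq c <- [:: 1; 2; 3] | nth v (v :: N) c \in nb F w] | w <- ws] = P ->
  {in F, forall e, uniq (L e) && (k <= size (L e))} ->
  (forall F', F' \subset F -> #|F'| < #|F| -> colourable F' L) ->
  colourable F L.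
Proof.
move=> us szN ch wf cnt P0 degk degv hws wsP hL IH.
have szP : size P = size ws by rewrite -wsP size_map.
pose phi := nth v (v :: N ++ ws).
have phiw i : phi (4 + i) = nth v ws i by rewrite /phi -[4 + i]/(3 + i).+1 /= nth_cat szN ltnNge leq_addr /= addKn.
have phiN c : c < 4 -> phi c = nth v (v :: N) c.
  by case: c => // c c3; rewrite /phi /= nth_cat szN ifT.
have nthP i : i < size P -> nth [::] P i =
    [seq c <- [:: 1; 2; 3] | nth v (v :: N) c \in nb F (nth v ws i)].
  by move=> iP; rewrite -wsP (nth_map v) // -szP.
have inj : {in gtn (4 + size P) &, injective phi}.
  have := @nth_uniq_inj v _ us; rewrite /= size_cat szN szP; exact.
have CF : {in leaf_edges P, forall e, img phi e \in F}.
  move=> e /mem_leaf_edges[c [i [-> iP]]].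
  have iws : i < size ws by rewrite -szP.
  have [vnb _] := hws _ (mem_nth v iws).
  rewrite /img phiw nthP // inE => /predU1P[->|]; first by rewrite inE in vnb.
  rewrite mem_filter => /andP[+ c3]; rewrite -phiN; last by move: c3; rewrite !inE; lia.
  by rewrite inE.
have cdeg i : i < 4 + size P -> count (touches i) (leaf_edges P) <= deg F (phi i).
  exact: count_touches_deg inj wf CF.
have Cne : leaf_edges P != [::] by case: (P) P0.
apply: (colourable_config inj wf CF _ hL ch Cne IH).
move=> e /mem_leaf_edges[c [i [-> iP cP]]] /=.
have iws : i < size ws by rewrite -szP.
have [_ degw] := hws _ (mem_nth v iws).
rewrite cnt // phiw degw -nthP // subnn addn0 /leaf_bound /=.
have c4 : c < 4.
  move: cP; rewrite nthP // inE => /predU1P[->//|].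
  by rewrite mem_filter !inE => /andP[_]; lia.
have := cdeg c (leq_trans c4 (leq_addr _ _)).
case: eqP => [->|_]; first by rewrite /phi /=; lia.
by have := degk (phi c); lia.
Qed.

Lemma colourable_hexagon F v (N ws : seq T) (L : {set T} -> seq nat) :
  uniq (v :: N ++ ws) -> size N = 3 -> size ws = 3 ->
  deg F v = 6 -> (forall u, deg F u <= 7) ->
  {in N, forall x, v \in nb F x} ->
  {in ws, forall w, v \in nb F w /\ deg F w = 3} ->
  [seq [seq c <- [:: 1; 2; 3] | nth v (v :: N) c \in nb F w] | w <- ws]
    = [:: [:: 1; 2]; [:: 1; 3]; [:: 2; 3]] ->
  {in F, forall e, uniq (L e) && (7 <= size (L e))} ->
  (forall F', F' \subset F -> #|F'| < #|F| -> colourable F' L) ->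
  colourable F L.
Proof.
case: N => [//|x [//|y [//|z [|//]]]]; case: ws => [//|p [//|q [//|r [|//]]]] us _ _ degv deg7 hN hws.
have [vp dp] := hws p (mem_head _ _).
have [vq dq] : v \in nb F q /\ deg F q = 3 by apply: hws; rewrite !inE eqxx orbT.
have [vr dr] : v \in nb F r /\ deg F r = 3 by apply: hws; rewrite !inE eqxx !orbT.
have vx : v \in nb F x by apply: hN; rewrite inE eqxx.
have vy : v \in nb F y by apply: hN; rewrite !inE eqxx orbT.
have vz : v \in nb F z by apply: hN; rewrite !inE eqxx !orbT.
have memt w t c : c \in [:: 1; 2; 3] ->
    [seq c <- [:: 1; 2; 3] | nth v [:: v; x; y; z] c \in nb F w] = t ->
    (nth v [:: v; x; y; z] c \in nb F w) = (c \in t).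
  by move=> c3 <-; rewrite mem_filter c3 andbT.
move=> tE hL IH.
have tpE := congr1 (fun s => nth [::] s 0) tE.
have tqE := congr1 (fun s => nth [::] s 1) tE.
have trE := congr1 (fun s => nth [::] s 2) tE.
have xp := memt p _ 1 isT tpE; have yp := memt p _ 2 isT tpE.
have xq := memt q _ 1 isT tqE; have zq := memt q _ 3 isT tqE.
have yr := memt r _ 2 isT trE; have zr := memt r _ 3 isT trE.
have inj := @nth_uniq_inj v _ us.
have CF : {in hexagon_edges, forall e, img (nth v [:: v; x; y; z; p; q; r]) e \in F}.
  apply/allP; rewrite /= /img /=.
  by move: vp vq vr vx vy vz xp yp xq zq yr zr; rewrite !inE /=
    => -> -> -> -> -> -> -> -> -> -> -> ->.
apply: (colourable_config (n := 7) inj _ CF _ hL hexagon_choosable _ IH) => //.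
apply/allP; rewrite /hexagon_bound /= degv dp dq dr.
move: (deg7 x) (deg7 y) (deg7 z); move: (deg F x) (deg F y) (deg F z); clear => a b c ha hb hc.
by do ![apply/andP; split]; lia.
Qed.
End BigDegree.

(** * The minimal counterexample for [k >= 7] *)

Section LargeK.
Variable T : finType.
Implicit Types (V K N W B : {set T}) (E F : {set {set T}}) (u v w q : T).

Lemma deg_sub F F' v : F' \subset F -> deg F' v <= deg F v.
Proof.
move=> /subsetP sub; apply/subset_leq_card/subsetP => e.
by rewrite !inE => /andP[/sub -> ->].
Qed.

Lemma pattern_count (s P ts : seq (seq nat)) :
  (forall t, count_mem t P <= count_mem t ts) -> (forall t, count_mem t ts <= count_mem t s) ->
  forall t, count_mem t P <= count_mem t s.
Proof. by move=> h1 h2 t; apply: leq_trans (h1 t) (h2 t). Qed.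

Lemma covers_four_of (s : seq (seq nat)) : 4 <= size s -> {subset s <= leaf_types} ->
  covers 0 (take 4 s).
Proof.
case: s => [//|a [//|b [//|c [//|d s]]]] _ sub; rewrite /= take0.
have [ha hb hc hd] : [/\ a \in leaf_types, b \in leaf_types, c \in leaf_types & d \in leaf_types].
  by split; apply: sub; rewrite !inE eqxx ?orbT.
have /allP/(_ _ ha)/allP/(_ _ hb)/allP/(_ _ hc)/allP/(_ _ hd) := covers_four.
exact.
Qed.

Lemma count_take_le (s : seq (seq nat)) n t : count_mem t (take n s) <= count_mem t s.
Proof. by rewrite -[in leqRHS](cat_take_drop n s) count_cat leq_addr. Qed.

Lemma perm_repeat (A : eqType) (s : seq A) : ~~ uniq s ->
  exists x s', perm_eq s (x :: x :: s').
Proof.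
elim: s => //= y s IH; rewrite negb_and negbK => /orP[ys|/IH[x [s' xs]]].
  by exists y, (rem y s); rewrite perm_cons perm_to_rem.
exists x, (y :: s'); rewrite -(perm_cons y) in xs; apply: perm_trans xs _.
by apply/permP => p /=; rewrite addnCA; congr (_ + _); rewrite addnCA.
Qed.

Lemma covers_three_of (s : seq (seq nat)) : 3 <= size s -> ~~ uniq s ->
  {subset s <= drop 3 leaf_types} ->
  exists ts, covers 1 ts /\ forall t, count_mem t ts <= count_mem t s.
Proof.
move=> s3 /perm_repeat[x [[|z s'] sE]] sub; first by rewrite (perm_size sE) in s3.
have mem y : y \in [:: x, x, z & s'] -> y \in drop 3 leaf_types.
  by rewrite -(perm_mem sE); exact: sub.
have xt : x \in drop 3 leaf_types by apply: mem; rewrite mem_head.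
have zt : z \in drop 3 leaf_types by apply: mem; rewrite !inE eqxx !orbT.
exists [:: x; x; z]; split.
  have /allP/(_ _ xt)/allP/(_ _ xt)/allP/(_ _ zt) := covers_three.
  by rewrite /= inE eqxx.
by move=> t; rewrite (permP sE) /= addn0 !addnA leq_addr.
Qed.

Lemma filter_leaf_types (p : pred nat) :
  (0 < size [seq c <- [:: 1; 2; 3] | p c] <= 2 -> [seq c <- [:: 1; 2; 3] | p c] \in leaf_types) /\
  (size [seq c <- [:: 1; 2; 3] | p c] = 2 -> [seq c <- [:: 1; 2; 3] | p c] \in drop 3 leaf_types).
Proof. by rewrite /=; case: (p 1); case: (p 2); case: (p 3). Qed.

Theorem edges_choosable_large k V E F : three_tree_on V E -> F \subset E -> 7 <= k ->
  (forall u, deg F u <= k) -> edges_choosable F k.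
Proof.
move=> tE FE k7 dk L hL.
have light_heavy a b : ~~ (k.+2 <= 2 * a) -> k.+2 <= b + a -> k.+2 <= 2 * b by clear -k7; lia.
have [n] := ubnP #|F|; elim: n F FE dk hL => // n IHn F FE dk hL Fn.
have IH F' : F' \subset F -> #|F'| < #|F| -> colourable F' L.
  move=> sub lt; apply: IHn (leq_trans lt _) => //.
  - exact: subset_trans FE.
  - by move=> u; apply: leq_trans (deg_sub u sub) (dk u).
  - by move=> e eF'; apply/hL/(subsetP sub).
have EV := three_tree_pairs tE; have FV := subset_trans FE EV.
have [/existsP[a /existsP[b /and3P[ab abF light]]]|heavy] := boolP
    [exists a, exists b, [&& a != b, [set a; b] \in F & deg F a + deg F b <= k.+1]].
  exact: colourable_light_edge ab abF light hL IH.
have {}heavy u w : u \in nb F w -> k.+2 <= deg F u + deg F w.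
  rewrite inE => uwF; have [_ _ uw] := pair_mem FV uwF.
  move: heavy; rewrite negb_exists => /forallP/(_ u); rewrite negb_exists => /forallP/(_ w).
  by rewrite uw uwF /= -ltnNge.
have [F0|[e eF]] := set_0Vmem F.
  by exists (fun=> 0); split=> [e|e]; rewrite F0 inE.
pose B := [set v | k.+2 <= 2 * deg F v].
have BV : B :&: V != set0.
  have /cards2P[a [b [ab eab]]] : #|e| == 2 by rewrite (card_pair FV eF).
  rewrite eab in eF; have [aV bV _] := pair_mem FV eF.
  have := heavy a b; rewrite inE eF => /(_ isT) hab; apply/set0Pn.
  have [le|lt] := leqP (deg F a) (deg F b).
    by exists b; rewrite !inE bV andbT; lia.
  by exists a; rewrite !inE aV andbT; lia.
have [v [N [W [vB vN cN nbv [WV hW]]]]] := three_tree_last tE BV.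
have subnb u : nb F u \subset nb E u by apply/subsetP => x; rewrite !inE; exact: (subsetP FE).
have vW : v \notin W by apply/negP => /(subsetP WV); rewrite inE vB.
(* [w] is outside [B], so by [light_heavy] all its neighbours in [F] belong to [B], where [hW]
   confines them. *)
have nbW w : w \in W -> nb F w \subset v |: N /\ deg F w <= 3.
  move=> wW; have := subsetP WV _ wW; rewrite inE => /andP[wB _].
  have nbB : nb F w \subset nb E w :&: B.
    apply/subsetP => u uw; rewrite in_setI (subsetP (subnb w)) //=.
    by move: wB; rewrite !inE => wB; exact: light_heavy wB (heavy u w uw).
  have [sub le3] := hW w wW; split; first exact: subset_trans sub.
  by rewrite (deg_nb _ FV) (leq_trans _ le3) // subset_leq_card.
pose WF := enum (nb F v :\: N).
have WFW w : w \in WF -> w \in W /\ v \in nb F w.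
  rewrite mem_enum inE nb_sym => /andP[wN wv]; split=> //.
  have := subsetP nbv w; rewrite (subsetP (subnb v)) 1?nb_sym // => /(_ isT).
  by rewrite inE (negbTE wN).
have szWF : deg F v <= size WF + #|N :&: nb F v|.
  by rewrite -cardE (deg_nb _ FV) -(cardsID N) addnC setIC.
have szN : size (enum N) = 3 by rewrite -cardE.
have uvN : uniq (v :: enum N) by rewrite /= mem_enum vN enum_uniq.
pose tau w := [seq c <- [:: 1; 2; 3] | nth v (v :: enum N) c \in nb F w].
have degtau w : w \in WF -> deg F w = (size (tau w)).+1.
  move=> /WFW[wW vw]; have [sub _] := nbW w wW.
  have -> : deg F w = count [in nb F w] (v :: enum N).
    rewrite (deg_nb _ FV) -size_filter -(card_uniqP (filter_uniq _ uvN)).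
    apply: eq_card => u; rewrite mem_filter in_cons mem_enum.
    by case: (boolP (u \in nb F w)) => //= /(subsetP sub); rewrite !inE.
  rewrite /tau /= vw; case: (enum N) szN => [//|x [//|y [//|z [|//]]]] _ /=.
  by do !case: (_ \in _).
have WFv w : w \in WF -> k.+2 <= deg F v + deg F w by move=> /WFW[_ /heavy].
have use slack ts : covers slack ts ->
    (forall t, count_mem t ts <= count_mem t (map tau WF)) -> deg F v + slack <= k ->
    colourable F L.
  move=> /coversP[P [ch wf cnt P0 hP]] hts degv.
  have [ws [uws wsWF wsP]] := pick_by_type (enum_uniq _) (pattern_count hP hts).
  apply: (colourable_leaves _ szN ch wf cnt P0 dk degv _ wsP hL IH) => [|w /wsWF wWF].
    rewrite -cat_cons cat_uniq uvN uws andbT /=; apply/hasPn => w /wsWF wWF.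
    have [wW _] := WFW w wWF; rewrite inE negb_or (contraNneq _ vW) => [|<-//].
    by move: wWF; rewrite !mem_enum inE => /andP[].
  by split; [have [] := WFW w wWF|exact: degtau].
have N3 : #|N :&: nb F v| <= 3 by rewrite -cN subset_leq_card // subsetIl.
have dv5 : 5 <= deg F v by move: vB; rewrite inE; clear -k7; lia.
have [w0 w0WF] : exists w, w \in WF.
  by case: (WF) szWF => [/=|w s _]; [clear -N3 dv5; lia|exists w; rewrite mem_head].
have dw3 w : w \in WF -> deg F w <= 3 by move=> /WFW[wW _]; have [] := nbW w wW.
(* A leaf [w0] has degree at most 3 and [deg F v + deg F w0 >= k + 2]. In the first case there are
   at least [k - 3 >= 4] leaves, of degree 2 or 3. *)
have [dvk|dvk] : deg F v = k \/ deg F v = k.-1.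
  by have := dk v; have := WFv _ w0WF; have := dw3 _ w0WF; clear; lia.
  apply: (use 0 (take 4 (map tau WF))) => [|t|]; first last.
  - by rewrite addn0 dvk.
  - exact: count_take_le.
  - apply: covers_four_of; first by rewrite size_map; clear -szWF N3 dvk k7; lia.
    move=> _ /mapP[w wWF ->]; apply: (filter_leaf_types _).1.
    by have := degtau w wWF; have := dw3 w wWF; have := WFv w wWF; rewrite -/(tau w) dvk; clear; lia.
(* Now [deg F v = k - 1]: the leaves have degree exactly 3, there are at least [k - 4 >= 3] of them,
   and [v] has slack 1. *)
have sub3 : {subset map tau WF <= drop 3 leaf_types}.
  move=> _ /mapP[w wWF ->]; apply: (filter_leaf_types _).2.
  by have := degtau w wWF; have := dw3 w wWF; have := WFv w wWF; rewrite -/(tau w) dvk; clear -k7; lia.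
have sz3 : 3 <= size (map tau WF) by rewrite size_map; clear -szWF N3 dvk k7; lia.
have [ut|nut] := boolP (uniq (map tau WF)); last first.
  have [ts [cov cnt]] := covers_three_of sz3 nut sub3.
  by apply: use cov cnt _; clear -dvk k7; lia.
(* With distinct types there are at most three leaves, so [k - 1 = deg F v <= 6]. *)
have szt : size (map tau WF) <= 3 by exact: uniq_leq_size ut sub3.
have [k_7 dv6 N_3] : [/\ k = 7, deg F v = 6 & #|N :&: nb F v| = 3].
  by move: szt sz3; rewrite size_map; clear -szWF N3 dvk k7; move=> *; split; lia.
have [_ eqt] := uniq_min_size ut sub3 sz3.
have [|ws [uws wsWF wsP]] := pick_by_type (tau := tau) (P := drop 3 leaf_types) (enum_uniq (nb F v :\: N)).
  by move=> t; rewrite -/WF !count_uniq_mem // eqt.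
have szws : size ws = 3 by rewrite -(size_map tau) wsP.
apply: (colourable_hexagon _ szN szws dv6 _ _ _ wsP _ IH).
- rewrite -cat_cons cat_uniq uvN uws andbT /=; apply/hasPn => w /wsWF wWF.
  have [wW _] := WFW w wWF; rewrite inE negb_or (contraNneq _ vW) => [|<-//].
  by move: wWF; rewrite !mem_enum inE => /andP[].
- by move=> u; rewrite -k_7.
- move=> x; rewrite mem_enum => xN; rewrite nb_sym.
  have /eqP NI : N :&: nb F v == N by rewrite eqEcard subsetIl N_3 cN.
  by rewrite -NI inE in xN; case/andP: xN.
- move=> w /wsWF wWF; split; first by have [] := WFW w wWF.
  by have := dw3 w wWF; have := WFv w wWF; clear -k_7 dv6; lia.
- by move=> g /hL; rewrite k_7.
Qed.
End LargeK.

(** * 3-trees with at most 8 vertices *)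

(* Up to isomorphism, the 3-trees with at most 8 vertices and, when there are
   8 of them, maximum degree 6: number of vertices, chromatic index, edges, and
   exponents of a monomial with nonzero coefficient in the graph polynomial of
   the line graph. *)
Definition small_trees : seq (nat * nat * seq (nat * nat) * seq nat) :=
  [:: (4, 3,
    [:: (0, 1); (0, 2); (0, 3); (1, 2); (1, 3); (2, 3)],
    [:: 2; 2; 2; 2; 2; 2]);
      (5, 5,
    [:: (1, 2); (0, 2); (2, 4); (0, 1); (2, 3); (0, 4); (1, 3); (1, 4); (0, 3)],
    [:: 0; 1; 2; 2; 3; 4; 4; 4; 4]);
      (6, 5,
    [:: (0, 1); (1, 3); (0, 4); (0, 2); (0, 5); (0, 3); (3, 5); (1, 5); (1, 2); (1, 4);
        (2, 3); (2, 4)],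
    [:: 0; 1; 4; 1; 4; 4; 4; 4; 4; 4; 4; 4]);
      (6, 5,
    [:: (0, 2); (0, 1); (0, 3); (2, 5); (2, 3); (0, 5); (0, 4); (2, 4); (1, 5); (1, 3);
        (1, 2); (1, 4)],
    [:: 0; 1; 4; 4; 4; 4; 3; 4; 4; 3; 4; 4]);
      (7, 6,
    [:: (0, 1); (0, 2); (0, 5); (1, 5); (0, 4); (2, 4); (1, 4); (0, 3); (1, 2); (1, 3);
        (0, 6); (2, 3); (2, 6); (4, 6); (3, 5)],
    [:: 0; 1; 2; 2; 3; 2; 4; 4; 5; 5; 5; 5; 5; 5; 5]);
      (7, 6,
    [:: (0, 1); (1, 2); (2, 3); (1, 3); (0, 2); (0, 3); (0, 4); (0, 6); (0, 5); (3, 6);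
        (1, 4); (2, 6); (2, 4); (3, 5); (1, 5)],
    [:: 0; 1; 1; 3; 3; 4; 4; 5; 3; 5; 5; 5; 5; 5; 5]);
      (7, 6,
    [:: (0, 1); (2, 3); (1, 2); (0, 2); (0, 3); (1, 3); (0, 5); (0, 4); (0, 6); (2, 4);
        (2, 5); (1, 5); (1, 4); (1, 6); (3, 6)],
    [:: 0; 0; 2; 3; 3; 4; 3; 5; 5; 5; 5; 5; 5; 5; 5]);
      (7, 6,
    [:: (0, 2); (1, 2); (0, 1); (2, 3); (0, 6); (1, 3); (0, 3); (2, 6); (2, 5); (2, 4);
        (0, 5); (0, 4); (1, 6); (1, 4); (1, 5)],
    [:: 0; 1; 2; 2; 5; 4; 5; 5; 5; 4; 4; 5; 5; 5; 5]);
      (7, 6,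
    [:: (1, 3); (1, 2); (0, 2); (2, 3); (0, 1); (0, 3); (0, 4); (1, 4); (1, 5); (0, 6);
        (1, 6); (0, 5); (2, 4); (4, 6); (3, 5)],
    [:: 0; 1; 1; 3; 3; 4; 3; 4; 5; 5; 5; 5; 5; 5; 5]);
      (8, 6,
    [:: (0, 1); (2, 3); (1, 2); (0, 3); (0, 2); (1, 3); (1, 7); (1, 5); (2, 4); (2, 7);
        (1, 4); (0, 4); (0, 5); (3, 7); (3, 6); (3, 5); (2, 6); (0, 6)],
    [:: 0; 0; 2; 2; 4; 4; 5; 5; 5; 5; 5; 5; 5; 5; 5; 5; 5; 5]);
      (8, 6,
    [:: (0, 2); (2, 3); (1, 2); (0, 1); (1, 3); (0, 3); (0, 4); (1, 7); (1, 4); (1, 5);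
        (0, 5); (2, 4); (3, 5); (3, 7); (0, 6); (2, 6); (5, 7); (4, 6)],
    [:: 0; 1; 2; 2; 3; 4; 3; 3; 5; 5; 5; 5; 5; 5; 5; 5; 5; 5]);
      (8, 6,
    [:: (1, 3); (1, 2); (0, 3); (0, 2); (2, 3); (0, 1); (2, 7); (1, 7); (2, 4); (1, 4);
        (0, 6); (0, 4); (2, 6); (3, 6); (1, 5); (0, 5); (3, 5); (4, 7)],
    [:: 0; 1; 1; 2; 4; 4; 5; 5; 5; 3; 5; 5; 5; 5; 5; 5; 5; 5])].

Definition order_of (x : nat * nat * seq (nat * nat) * seq nat) := x.1.1.1.
Definition index_of (x : nat * nat * seq (nat * nat) * seq nat) := x.1.1.2.
Definition edges_of (x : nat * nat * seq (nat * nat) * seq nat) := x.1.2.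

Definition joined (C : seq (nat * nat)) (i j : nat) : bool :=
  ((i, j) \in C) || ((j, i) \in C).

Fixpoint first_some (A B : Type) (g : A -> option B) (s : seq A) : option B :=
  if s is x :: s' then if g x is Some y then Some y else first_some g s' else None.

(** An untrusted backtracking search; [isomorphic] checks its answer with [is_iso]. *)
Fixpoint find_iso (m n : nat) (C D : seq (nat * nat)) (s : seq nat) : option (seq nat) :=
  if m is m'.+1 then
    first_some (fun j =>
      if [&& j \notin s, count (touches (size s)) C == count (touches j) D &
             all (fun i => joined C i (size s) == joined D (nth 0 s i) j) (iota 0 (size s))]
      then find_iso m' n C D (rcons s j) else None) (iota 0 n)
  else Some s.

Definition move_edge (s : seq nat) (e : nat * nat) : nat * nat :=
  (minn (nth 0 s e.1) (nth 0 s e.2), maxn (nth 0 s e.1) (nth 0 s e.2)).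

Definition is_iso (n : nat) (C D : seq (nat * nat)) (s : seq nat) : bool :=
  perm_eq s (iota 0 n) && perm_eq (map (move_edge s) C) D.

Definition isomorphic (n : nat) (C D : seq (nat * nat)) : bool :=
  if find_iso n n C D [::] is Some s then is_iso n C D s else false.

Definition add_vertex (n a b c : nat) (C : seq (nat * nat)) : seq (nat * nat) :=
  C ++ [:: (a, n); (b, n); (c, n)].

Definition max_deg_le (n d : nat) (C : seq (nat * nat)) : bool :=
  all (fun i => count (touches i) C <= d) (iota 0 n).

(** This is the induction step of [small_classification]. The nested [if] keep call-by-value
    evaluation from starting needless isomorphism searches. *)
Definition small_closed : bool :=
  all (fun x => let n := order_of x in let C := edges_of x in
    if n < 8 then
      all (fun a => all (fun b => if (a, b) \in C then all (fun c =>
        if [&& (a, c) \in C, (b, c) \in C & max_deg_le n.+1 6 (add_vertex n a b c C)]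
        then has (fun y => if order_of y == n.+1
                           then isomorphic n.+1 (add_vertex n a b c C) (edges_of y)
                           else false) small_trees
        else true) (iota 0 n) else true) (iota 0 n)) (iota 0 n)
    else true) small_trees.

(** The last conjunct serves the lower bound on the number of colours: a vertex of degree
    [index_of x] or, on five vertices, nine edges. *)
Definition small_valid : bool :=
  all (fun x => [&& well_formed (order_of x) (edges_of x),
    alon_tarsi_cert (edges_of x) (fun=> index_of x) x.2,
    (order_of x <= 6) || (index_of x == 6) &
    if order_of x == 5 then (size (edges_of x) == 9) && (index_of x == 5)
    else has (fun i => count (touches i) (edges_of x) == index_of x) (iota 0 (order_of x))])
  small_trees.

Lemma small_closedT : small_closed. Proof. by vm_compute. Qed.
Lemma small_validT : small_valid. Proof. by vm_compute. Qed.

Section Drawing.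
Variable T : finType.
Implicit Types (V K : {set T}) (E F : {set {set T}}) (C D : seq (nat * nat)) (phi : nat -> T).

Definition drawn V E (n : nat) C : Prop :=
  exists phi : nat -> T, [/\ {in gtn n &, injective phi}, well_formed n C,
    V =i map phi (iota 0 n) & E =i map (img phi) C].

Lemma drawn_deg n phi C E i : {in gtn n &, injective phi} -> well_formed n C ->
  E =i map (img phi) C -> i < n -> deg E (phi i) = count (touches i) C.
Proof.
move=> inj wf EC i_n; rewrite (@deg_outer _ n phi C inj wf E _ i i_n).
  rewrite /deg (_ : [set e in _ | _] = set0) ?cards0 //.
  by apply/setP => e; rewrite !inE -EC; case: (e \in E).
by move=> e eC; rewrite EC map_f.
Qed.

Lemma drawn_edge n phi C a b : {in gtn n &, injective phi} -> well_formed n C ->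
  a < b < n -> [set phi a; phi b] \in map (img phi) C -> (a, b) \in C.
Proof.
move=> inj wf /andP[ab bn] /mapP[e eC eqs].
have [e1 e2 e12] := well_formedP wf eC.
have := mem_img inj wf (ltn_trans ab bn) eC; rewrite -eqs set21 /touches => /esym ta.
have := mem_img inj wf bn eC; rewrite -eqs set22 /touches => /esym tb.
suff -> : (a, b) = e by [].
by case: e {eC eqs e1 e2} e12 ta tb => x y /= *; congr pair; lia.
Qed.

Lemma drawn_iso V E n C D : drawn V E n C -> well_formed n D -> isomorphic n C D ->
  drawn V E n D.
Proof.
move=> [phi [inj wf VC EC]] wfD.
rewrite /isomorphic; case: find_iso => // s /andP[sn sD].
have szs : size s = n by rewrite (perm_size sn) size_iota.
have us : uniq s by rewrite (perm_uniq sn) iota_uniq.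
have mems i : (i \in s) = (i < n) by rewrite (perm_mem sn) mem_iota.
pose psi i := phi (index i s).
have psis i : i < n -> psi (nth 0 s i) = phi i.
  by move=> i_n; rewrite /psi index_uniq // szs.
exists psi; split=> //.
- move=> i j; rewrite !inE -!mems => si sj /inj; rewrite !inE -szs !index_mem => /(_ si sj).
  by move=> eqi; rewrite -(nth_index 0 si) eqi nth_index.
- move=> v; rewrite VC; apply/mapP/mapP => -[i]; rewrite mem_iota => /= i_n ->.
    exists (nth 0 s i); last by rewrite psis.
    by rewrite mem_iota /= -mems mem_nth // szs.
  by exists (index i s); rewrite ?mem_iota //= -szs index_mem mems.
- move=> e; rewrite EC -(perm_mem (perm_map (img psi) sD)) -map_comp.
  suff -> : map (img phi) C = map (img psi \o move_edge s) C by [].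
  apply/eq_in_map => -[a b] /(well_formedP wf)[/= an bn _].
  rewrite /img /= -(psis a) // -(psis b) //.
  by case: leqP => _; rewrite // setUC.
Qed.

Lemma drawn_add V E K q n C : three_tree_on V E -> drawn V E n C -> q \notin V ->
  K \subset V -> #|K| = 3 -> pairs K \subset E ->
  exists a b c, [/\ (a, b) \in C, (a, c) \in C, (b, c) \in C, a < b < c & c < n] /\
    drawn (q |: V) (E :|: [set [set u; q] | u in K]) n.+1 (add_vertex n a b c C).
Proof.
move=> tE [phi [inj wf VC EC]] qV KV cK KE.
(* Filtering [iota] gives the indices of [K] in increasing order, as the edges in [C] are stored. *)
pose t := [seq i <- iota 0 n | phi i \in K].
have injphi : {in iota 0 n &, injective phi}.
  by move=> i j; rewrite !mem_iota /=; exact: inj.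
have tK : K =i map phi t.
  move=> u; apply/idP/mapP => [uK|[i]]; last by rewrite mem_filter => /andP[+ _] ->.
  have := subsetP KV _ uK; rewrite VC => /mapP[i iin eqs].
  by exists i; rewrite // mem_filter -eqs uK.
have szt : size t = 3.
  rewrite -cK (eq_card tK) -(size_map phi); apply/esym/card_uniqP.
  rewrite map_inj_in_uniq ?filter_uniq ?iota_uniq // => i j.
  by rewrite !mem_filter => /andP[_ ii] /andP[_ jj]; exact: injphi.
have : sorted ltn t by apply: sorted_filter (iota_ltn_sorted _ _); exact: ltn_trans.
have tn i : i \in t -> i < n by rewrite mem_filter mem_iota => /andP[].
case: t szt tK tn => [//|a [//|b [//|c [|//]]]] _ tK tn /and3P[ab bc _].
have {}ab : a < b := ab; have {}bc : b < c := bc.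
have cn : c < n by apply: tn; rewrite !inE eqxx !orbT.
have edge i j : i \in [:: a; b; c] -> j \in [:: a; b; c] -> i < j -> (i, j) \in C.
  move=> ii jj ij; apply: (drawn_edge inj wf); first by rewrite ij tn.
  rewrite -EC; apply: (subsetP KE); rewrite inE subUset !sub1set !tK !map_f //= cards2.
  by rewrite (inj_in_eq inj (tn _ ii : i \in gtn n) (tn _ jj : j \in gtn n)) (ltn_eqF ij).
exists a, b, c; split.
  have [ain bin cin] : [/\ a \in [:: a; b; c], b \in [:: a; b; c] & c \in [:: a; b; c]].
    by rewrite !inE !eqxx !orbT.
  have abc : a < b < c by rewrite ab bc.
  by split=> //; apply: edge => //; exact: ltn_trans bc.
have [an bn] : a < n /\ b < n by rewrite !(ltn_trans _ cn) // (ltn_trans ab).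
pose psi i := if i == n then q else phi i.
have psiE i : i < n -> psi i = phi i by move=> i_n; rewrite /psi ltn_eqF.
have psin : psi n = q by rewrite /psi eqxx.
have phiV i : i < n -> phi i \in V by move=> i_n; rewrite VC map_f // mem_iota.
have phiq i : i < n -> (phi i == q) = false.
  by move=> /phiV iV; apply: contraNF qV => /eqP <-.
have imgE e : e \in C -> img psi e = img phi e.
  by move=> /(well_formedP wf)[e1 e2 _]; rewrite /img !psiE.
exists psi; split.
- have split_n i : i \in gtn n.+1 -> i = n \/ i < n.
    by rewrite inE ltnS leq_eqVlt => /predU1P.
  move=> i j /split_n[->|i_n] /split_n[->|j_n] //; rewrite ?psin ?psiE //.
  + by move/esym/eqP; rewrite phiq.
  + by move/eqP; rewrite phiq.
  + exact: inj.
- have /andP[uC /allP wfC] := wf; apply/andP; split.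
    rewrite /add_vertex cat_uniq uC andTb; apply/andP; split.
      by apply/hasPn => e; rewrite !inE => /or3P[]/eqP->; apply/negP => /(well_formedP wf)[_];
        rewrite /= ltnn.
    rewrite /= !inE !xpair_eqE !eqxx !andbT.
    by rewrite (ltn_eqF ab) (ltn_eqF bc) (ltn_eqF (ltn_trans ab bc)).
  apply/allP => e; rewrite mem_cat => /orP[/wfC/andP[-> h]|]; first exact: ltnW.
  by rewrite !inE => /or3P[]/eqP->; rewrite /= ltnS leqnn ?an ?bn ?cn.
- move=> u; rewrite in_setU1 VC -addn1 iotaD map_cat mem_cat orbC /= psin inE.
  by congr (_ || _); apply/mapP/mapP => -[i]; rewrite mem_iota => /= i_n ->;
    exists i; rewrite ?mem_iota ?psiE.
move=> e; rewrite in_setU EC map_cat mem_cat; congr (_ || _).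
  by apply/mapP/mapP => -[f fC ->]; exists f; rewrite ?imgE.
rewrite /img /= psin !psiE //; apply/imsetP/idP => [[u + ->]|].
  by rewrite tK !inE => /or3P[]/eqP->; rewrite eqxx ?orbT.
rewrite !inE => /or3P[]/eqP->.
- by exists (phi a); rewrite ?tK ?map_f // inE eqxx.
- by exists (phi b); rewrite ?tK ?map_f // !inE eqxx ?orbT.
- by exists (phi c); rewrite ?tK ?map_f // !inE eqxx ?orbT.
Qed.
End Drawing.

Section Small.
Variable T : finType.
Implicit Types (V K : {set T}) (E F : {set {set T}}).

Lemma small_treesP x : x \in small_trees ->
  [/\ well_formed (order_of x) (edges_of x),
    choosable (edges_of x) (fun=> index_of x),
    6 < order_of x -> index_of x = 6,
    order_of x = 5 -> size (edges_of x) = 9 /\ index_of x = 5 &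
    order_of x <> 5 -> exists2 i, i < order_of x & count (touches i) (edges_of x) = index_of x].
Proof.
have /allP h := small_validT; move=> /h /and4P[wf cert]; rewrite leqNgt -implybE => /implyP i6.
case: eqP => [n5|n5].
  move=> /andP[/eqP sz /eqP k5]; split=> // [|/i6/eqP//]; exact: alon_tarsi_choosable cert.
move=> /hasP[i]; rewrite mem_iota => /= i_n /eqP ci.
by split=> // [|/i6/eqP//|_]; [exact: alon_tarsi_choosable cert|exists i].
Qed.

Lemma drawn_complete V : #|V| = 4 -> drawn V (pairs V) 4 (edges_of (head (0, 0, [::], [::]) small_trees)).
Proof.
move=> cV; have szV : size (enum V) = 4 by rewrite -cardE.
have [x0 _] : exists x, x \in V by apply/card_gt0P; rewrite cV.
pose phi := nth x0 (enum V).
have inj : {in gtn 4 &, injective phi}.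
  by rewrite -szV; exact: nth_uniq_inj (enum_uniq _).
have VC u : (u \in V) = (u \in map phi (iota 0 4)).
  by rewrite -mem_enum -szV -/(mkseq phi _) mkseq_nth.
have VP u : u \in V -> exists2 i, i < 4 & u = phi i.
  by rewrite VC => /mapP[i]; rewrite mem_iota; exists i.
exists phi; split=> // e.
apply/idP/mapP => [|[[i j] ij ->]].
  rewrite inE => /andP[eV /cards2P[x [y [xy exy]]]].
  have [i i4 xi] : exists2 i, i < 4 & x = phi i by apply/VP/(subsetP eV); rewrite exy set21.
  have [j j4 yj] : exists2 i, i < 4 & y = phi i by apply/VP/(subsetP eV); rewrite exy set22.
  have all_edges a b : a < b -> b < 4 -> (a, b) \in edges_of (head (0, 0, [::], [::]) small_trees).
    by do 4?[case: b => [//|b]]; do 3?[case: a => [//|a]].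
  have [lt|lt|eq] := ltngtP i j.
  - by exists (i, j); rewrite ?all_edges // exy xi yj.
  - by exists (j, i); rewrite ?all_edges // exy xi yj setUC.
  - by rewrite xi yj eq eqxx in xy.
have [//|/= i4 j4 ij'] := @well_formedP 4 _ _ (i, j) ij.
rewrite inE subUset !sub1set /= !VC !map_f ?mem_iota //= cards2.
by rewrite (inj_in_eq inj (i4 : i \in gtn 4) (j4 : j \in gtn 4)) (ltn_eqF ij').
Qed.

Lemma small_classification V E : three_tree_on V E -> #|V| <= 8 -> (forall u, deg E u <= 6) ->
  exists2 x, x \in small_trees & order_of x = #|V| /\ drawn V E (order_of x) (edges_of x).
Proof.
elim=> [{}V cV _ _|{}V {}E K q tE IH qV KV cK KE].
  exists (head (0, 0, [::], [::]) small_trees); first by rewrite mem_head.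
  by rewrite cV; split=> //; exact: drawn_complete.
rewrite cardsU1 qV add1n => cV degE.
have [||x xin [ordx dr]] := IH; first exact: ltnW.
  by move=> u; apply: leq_trans (degE u); apply: deg_sub; exact: subsetUl.
have [a [b [c [[ab ac bc /andP[a_b b_c] cn] dr']]]] := drawn_add tE dr qV KV cK KE.
have n8 : order_of x < 8 by rewrite ordx.
have /allP/(_ _ xin) := small_closedT; cbv beta zeta; rewrite n8.
have in_n i : i < order_of x -> i \in iota 0 (order_of x) by rewrite mem_iota.
move=> /allP/(_ a (in_n _ (ltn_trans a_b (ltn_trans b_c cn)))).
move=> /allP/(_ b (in_n _ (ltn_trans b_c cn))); rewrite ab => /allP/(_ c (in_n _ cn)).
rewrite ac bc; have -> : max_deg_le (order_of x).+1 6 (add_vertex (order_of x) a b c (edges_of x)).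
  apply/allP => i; rewrite mem_iota => /= i_n; case: (dr') => phi [inj wf _ EC].
  by rewrite -(drawn_deg inj wf EC i_n).
move=> /hasP[y yin]; case: eqP => // ordy iso; have [wfy _ _ _ _] := small_treesP yin.
exists y => //; rewrite ordy ordx; split=> //; rewrite -ordx.
by apply: drawn_iso dr' _ iso; rewrite -ordy.
Qed.

Lemma drawn_choosable V E n C k : drawn V E n C -> choosable C (fun=> k) ->
  edges_choosable E k.
Proof.
move=> [phi [inj wf _ EC]] ch L hL.
apply: (@extend_colouring _ n phi C inj wf E k [::] (fun=> k)) => //.
- by move=> e eC; rewrite EC map_f.
- by move=> e eC; have [e1 e2 _] := well_formedP wf eC; rewrite !(drawn_deg inj wf EC) // !subnn !addn0.
- by move=> R hR _; exact: ch.
exists (fun=> 0); suff h e : e \notin [set g in E | g \notin [seq img phi e | e <- C & e \notin [::]]].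
  by split=> [e|e]; rewrite (negbTE (h e)).
rewrite inE EC filter_predT; by case: (e \in _).
Qed.

(** Degrees never drop as vertices are added, so seven vertices decide. If all degrees were below 6
    there, the tree would be isomorphic to a listed one, which has a vertex of degree 6. *)
Lemma max_deg_large V E : three_tree_on V E -> 7 <= #|V| -> exists u, 6 <= deg E u.
Proof.
move=> tE; elim: V E / tE => [V -> //|V E K q tE IH qV KV cK KE].
have tE' := AddVertex tE qV KV cK KE; rewrite cardsU1 qV add1n ltnS leq_eqVlt.
case/predU1P => [cV|/IH[u hu]]; last first.
  by exists u; apply: leq_trans hu _; apply: deg_sub; exact: subsetUl.
set E' := E :|: _ in tE' *.
have [/existsP[u hu]|/existsPn small] := boolP [exists u, 6 <= deg E' u]; first by exists u.
have cV' : #|q |: V| = 7 by rewrite cardsU1 qV -cV.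
have [||x xin [ordx [phi [inj wf _ EC]]]] := small_classification tE'; first by rewrite cV'.
  by move=> u; have := small u; rewrite -ltnNge; exact: ltnW.
rewrite cV' in ordx; have [_ _ i6 _] := small_treesP xin; rewrite ordx i6 ?ordx //.
by case=> // i i7 ci; exists (phi i); rewrite (drawn_deg inj wf EC) ?ci ?ordx.
Qed.

Lemma small_choosable V E : three_tree_on V E -> 7 <= #|V| <= 8 -> (forall u, deg E u <= 6) ->
  edges_choosable E 6.
Proof.
move=> tE /andP[V7 V8] degE; have [x xin [ordx dr]] := small_classification tE V8 degE.
have [_ ch i6 _ _] := small_treesP xin; rewrite i6 ?ordx // in ch.
exact: drawn_choosable dr ch.
Qed.
End Small.

(** * 3-trees of maximum degree 6 *)

Section Leaves.
Variable T : finType.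
Implicit Types (V K S U : {set T}) (E F : {set {set T}}) (u v w q : T).

Definition induced E U : {set {set T}} := [set e in E | e \subset U].

Lemma nb_induced E U u v : (u \in nb (induced E U) v) = [&& u \in nb E v, u \in U & v \in U].
Proof. by rewrite !inE subUset !sub1set. Qed.

Lemma induced_pairs V E U : E \subset pairs V -> induced E U \subset pairs U.
Proof.
move=> /subsetP EV; apply/subsetP => e; rewrite !inE => /andP[/EV + ->].
by rewrite inE => /andP[_ ->].
Qed.

Lemma induced_induced E U U' : U' \subset U -> induced (induced E U) U' = induced E U'.
Proof.
move=> UU; apply/setP => e; rewrite !inE -andbA; congr (_ && _).
by case: (boolP (e \subset U')) => [h|_]; rewrite ?andbF // (subset_trans h).
Qed.

Lemma nb_pairs V u v : v \in V -> (u \in nb (pairs V) v) = (u \in V :\ v).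
Proof.
by move=> vV; rewrite !inE subUset !sub1set cards2 vV andbT; case: (u == v); rewrite ?andbF ?andbT.
Qed.

Lemma nb_new V E K q : E \subset pairs V -> q \notin V -> K \subset V ->
  nb (E :|: [set [set u; q] | u in K]) q = K.
Proof.
move=> EV qV KV; apply/setP => u; rewrite (nb_add _ _ _ EV qV) eqxx /= [u \in nb E q]inE.
have -> : ([set u; q] \in E) = false by apply: contraNF qV => /(pair_mem EV)[].
case: (boolP (u \in K)) => //= _; case: eqP => //= _.
by apply: contraNF qV; exact: subsetP.
Qed.

Lemma nb_old V E K q v : E \subset pairs V -> q \notin V -> v != q ->
  nb (E :|: [set [set u; q] | u in K]) v = nb E v :|: (if v \in K then [set q] else set0).
Proof.
move=> EV qV /negbTE vq; apply/setP => u; rewrite (nb_add _ _ _ EV qV) vq /= in_setU.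
by case: ifP; rewrite !inE ?andbT ?andbF.
Qed.

Lemma deg_old V E K q v : E \subset pairs V -> q \notin V -> K \subset V -> v != q ->
  deg (E :|: [set [set u; q] | u in K]) v = deg E v + (v \in K).
Proof.
move=> EV qV KV vq.
have EV' : E :|: [set [set u; q] | u in K] \subset pairs (q |: V).
  rewrite subUset; apply/andP; split; last first.
    apply/subsetP => _ /imsetP[u uK ->]; have uV := subsetP KV _ uK.
    by rewrite inE subUset !sub1set !inE uV eqxx orbT cards2 (contraNneq _ qV) // => <-.
  apply: subset_trans EV _; apply/subsetP => e; rewrite !inE => /andP[h ->].
  by rewrite (subset_trans h) // subsetUr.
rewrite (deg_nb _ EV') (deg_nb _ EV) (nb_old _ EV qV vq).
case: ifP => _; last by rewrite setU0 addn0.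
rewrite setUC cardsU1 addnC inE.
by rewrite (_ : _ \in E = false) //; apply: contraNF qV => /(pair_mem EV)[].
Qed.

Lemma three_tree_min_deg V E v : three_tree_on V E -> v \in V -> 3 <= deg E v.
Proof.
elim=> [{}V cV vV|{}V {}E K q tE IH qV KV cK KE].
  rewrite (deg_nb _ (subxx _)) (_ : nb _ v = V :\ v); last first.
    by apply/setP => u; rewrite nb_pairs.
  by have := cardsD1 v V; rewrite vV cV add1n => -[<-].
have EV := three_tree_pairs tE; have EV' := three_tree_pairs (AddVertex tE qV KV cK KE).
rewrite in_setU1 => /predU1P[->|vV].
  by rewrite (deg_nb _ EV') (nb_new EV) // cK.
by rewrite (leq_trans (IH vV)) // deg_sub // subsetUl.
Qed.

(** An old vertex in [K] gets degree at least 4, so a vertex of degree 3 is either the new one or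
    untouched by the last addition. *)
Lemma three_tree_leaf_clique V E v : three_tree_on V E -> deg E v = 3 ->
  {in nb E v &, forall x y, x != y -> x \in nb E y}.
Proof.
elim=> [{}V cV d3|{}V {}E K q tE IH qV KV cK KE].
  move=> x y; rewrite !inE => /andP[xV _] /andP[yV _] xy.
  by move: xV yV; rewrite !subUset !sub1set cards2 xy => /andP[-> _] /andP[-> _].
have EV := three_tree_pairs tE; have EV' := three_tree_pairs (AddVertex tE qV KV cK KE).
have [->|vq] := eqVneq v q.
  rewrite (nb_new EV) // => _ x y xK yK xy; rewrite inE in_setU (subsetP KE) //.
  by rewrite inE subUset !sub1set xK yK cards2 xy.
rewrite (deg_old EV) //; case: (boolP (v \in K)) => vK /=.
  by have := three_tree_min_deg tE (subsetP KV _ vK); lia.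
rewrite addn0 (nb_old _ EV qV vq) (negbTE vK) setU0 => /IH h x y xv yv xy.
by have := h x y xv yv xy; rewrite !inE => ->.
Qed.

Lemma induced_all V E : E \subset pairs V -> induced E V = E.
Proof.
move=> /subsetP EV; apply/setP => e; rewrite !inE; case: (boolP (e \in E)) => //= /EV.
by rewrite inE => /andP[].
Qed.

Lemma pairs_setU1 K q : q \notin K ->
  pairs (q |: K) = pairs K :|: [set [set u; q] | u in K].
Proof.
move=> qK; apply/setP => e; rewrite !inE.
apply/andP/orP => [[eK e2]|[/andP[eK ->]|/imsetP[u uK ->]]]; first last.
- by rewrite subUset !sub1set !inE uK eqxx orbT cards2 (contraNneq _ qK) // => <-.
- by rewrite (subset_trans eK) // subsetUr.
have [qe|qe] := boolP (q \in e); last first.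
  left; rewrite e2 andbT; apply/subsetP => u ue; have := subsetP eK _ ue.
  by rewrite in_setU1 => /predU1P[uq|//]; rewrite -uq ue in qe.
right; have /cards2P[x [y [xy exy]]] := e2; rewrite exy in qe eK *.
have [xK yK] : x \in q |: K /\ y \in q |: K by split; apply: (subsetP eK); rewrite !inE eqxx ?orbT.
move: qe; rewrite !inE => /orP[]/eqP qE; apply/imsetP.
  exists y; last by rewrite qE setUC.
  by move: yK; rewrite qE in_setU1 eq_sym (negbTE xy).
exists x; last by rewrite qE.
by move: xK; rewrite qE in_setU1 (negbTE xy).
Qed.

(** If [v] is not the last vertex [q], then [v] is outside [K], and its deletion commutes with the
    addition of [q]. The exception is [#|V| = 4] before adding [q]: then [V :\ v] is [K], and what
    remains is the complete graph on [q |: K]. *)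
Lemma three_tree_del V E v : three_tree_on V E -> 5 <= #|V| -> v \in V -> deg E v = 3 ->
  three_tree_on (V :\ v) (induced E (V :\ v)).
Proof.
elim=> [{}V -> //|{}V {}E K q tE IH qV KV cK KE].
have EV := three_tree_pairs tE; have tE' := AddVertex tE qV KV cK KE.
have EV' := three_tree_pairs tE'.
rewrite cardsU1 qV add1n ltnS => V4; rewrite in_setU1.
have [->|vq /=] := eqVneq v q.
  move=> _ _; have -> : (q |: V) :\ q = V by rewrite setU1K.
  have -> // : induced (E :|: [set [set u; q] | u in K]) V = E.
  apply/setP => e; rewrite inE in_setU; apply/andP/idP => [[/orP[//|/imsetP[u _ ->]]]|eE].
    by rewrite subUset !sub1set (negbTE qV) andbF.
  by rewrite eE; split=> //; have := subsetP EV _ eE; rewrite inE => /andP[].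
move=> vV; rewrite (deg_old EV) //; case: (boolP (v \in K)) => vK /=.
  by have := three_tree_min_deg tE vV; lia.
rewrite addn0 => d3.
have qVv : q \notin V :\ v by rewrite !inE (negbTE qV) andbF.
have KVv : K \subset V :\ v by rewrite subsetD1 KV.
have VE : (q |: V) :\ v = q |: (V :\ v).
  by apply/setP => u; rewrite !inE; case: (u =P q) => [->|]; rewrite ?(eq_sym q) ?vq.
have EE : induced (E :|: [set [set u; q] | u in K]) (q |: (V :\ v))
    = induced E (V :\ v) :|: [set [set u; q] | u in K].
  apply/setP => e; rewrite !inE; have [/imsetP[u uK ->]|_] := boolP (e \in [set [set u; q] | u in K]).
    by rewrite !orbT /= subUset !sub1set in_setU1 (subsetP KVv _ uK) setU11 orbT.
  rewrite !orbF; case: (boolP (e \in E)) => //= /(subsetP EV); rewrite inE => /andP[eV _].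
  apply/idP/idP => [|h]; last by rewrite (subset_trans h) // subsetUr.
  move=> /subsetP h; apply/subsetP => u ue; have := h u ue; rewrite in_setU1 => /predU1P[uq|//].
  by move: qV; rewrite -uq (subsetP eV).
rewrite VE EE; move: V4; rewrite leq_eqVlt => /predU1P[V4|V5]; last first.
  apply: AddVertex => //; first exact: IH.
  apply/subsetP => e eK; rewrite inE (subsetP KE) //.
  by move: eK; rewrite inE => /andP[/subset_trans ->].
have VvK : V :\ v = K.
  by apply/esym/eqP; rewrite eqEcard KVv cK; have := cardsD1 v V; rewrite vV -V4 add1n => -[<-].
have -> : induced E (V :\ v) = pairs K.
  apply/eqP; rewrite eqEsubset VvK (induced_pairs _ EV) /=.
  by apply/subsetP => e eK; rewrite inE (subsetP KE) //; move: eK; rewrite inE => /andP[].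
rewrite VvK -pairs_setU1 //; last by rewrite -VvK.
by apply: Complete4; rewrite cardsU1 cK -VvK qVv.
Qed.

Lemma nb_induced_setI V E U v : v \in U -> nb (induced E U) v = nb E v :&: U.
Proof. by move=> vU; apply/setP => u; rewrite nb_induced vU andbT in_setI. Qed.

(** Otherwise deleting [a] would leave a 3-tree in which [b] has degree 2. *)
Lemma three_tree_leaves_apart V E a b : three_tree_on V E -> 5 <= #|V| ->
  deg E a = 3 -> deg E b = 3 -> a \notin nb E b.
Proof.
move=> tE V5 da db; apply/negP => ab; have EV := three_tree_pairs tE.
have [aV bV a_b] : [/\ a \in V, b \in V & a != b].
  by move: ab; rewrite inE => /(pair_mem EV).
have tD := three_tree_del tE V5 aV da.
have bD : b \in V :\ a by rewrite !inE eq_sym a_b.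
have := three_tree_min_deg tD bD.
rewrite (deg_nb _ (three_tree_pairs tD)) (nb_induced_setI V) //.
suff : #|nb E b :&: (V :\ a)| < #|nb E b| by rewrite -(deg_nb _ EV) db; lia.
apply/proper_card/properP; split; first exact: subsetIl.
by exists a; rewrite // !inE eqxx /= andbF.
Qed.

(** The last vertex is one leaf. Two leaves of the previous tree are not adjacent, so one of them is
    outside the clique [K] and remains a leaf. *)
Lemma three_tree_two_leaves V E : three_tree_on V E -> 5 <= #|V| ->
  exists a b, [/\ a \in V, b \in V, a != b & deg E a = 3 /\ deg E b = 3].
Proof.
elim=> [{}V -> //|{}V {}E K q tE IH qV KV cK KE].
have EV := three_tree_pairs tE; have EV' := three_tree_pairs (AddVertex tE qV KV cK KE).
rewrite cardsU1 qV add1n ltnS => V4.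
have dq : deg (E :|: [set [set u; q] | u in K]) q = 3.
  by rewrite (deg_nb _ EV') (nb_new EV) // cK.
suff [a [aV aK da]] : exists a, [/\ a \in V, a \notin K & deg E a = 3].
  have aq : a != q by apply: contraNneq qV => <-.
  exists a, q; rewrite !inE aV eqxx orbT aq; split=> //; split=> //.
  by rewrite (deg_old EV) // (negbTE aK) da.
move: V4; rewrite leq_eqVlt => /predU1P[V4|V5]; last first.
  have [a [b [aV bV ab [da db]]]] := IH V5.
  have [aK|aK] := boolP (a \in K); last by exists a.
  exists b; split=> //; apply: contra (three_tree_leaves_apart tE V5 da db) => bK.
  by rewrite inE (subsetP KE) // inE subUset !sub1set aK bK cards2 ab.
have /subsetPn[a aV aK] : ~~ (V \subset K).
  by apply: contraTN isT => /subset_leq_card; rewrite cK -V4.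
exists a; split=> //; apply/eqP; rewrite eqn_leq (three_tree_min_deg tE) // andbT.
have <- : #|V :\ a| = 3 by have := cardsD1 a V; rewrite aV -V4 add1n => -[<-].
rewrite (deg_nb _ EV); apply/subset_leq_card/subsetP => u; rewrite inE.
by move=> /(pair_mem EV)[uV _ ua]; rewrite !inE ua.
Qed.

Lemma three_tree_degree_sum V E : three_tree_on V E ->
  \sum_(v in V) deg E v + 12 = 6 * #|V|.
Proof.
elim=> [{}V cV|{}V {}E K q tE IH qV KV cK KE].
  rewrite cV (eq_bigr (fun=> 3)); first by rewrite sum_nat_const cV.
  move=> v vV; rewrite (deg_nb _ (subxx _)) (_ : nb _ v = V :\ v).
    by have := cardsD1 v V; rewrite vV cV add1n => -[<-].
  by apply/setP => u; rewrite nb_pairs.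
have EV := three_tree_pairs tE; have EV' := three_tree_pairs (AddVertex tE qV KV cK KE).
rewrite big_setU1 //= cardsU1 qV add1n mulnS -IH.
rewrite (deg_nb _ EV') (nb_new EV) // cK.
rewrite (eq_bigr (fun v => deg E v + (v \in K))); last first.
  by move=> v vV; rewrite (deg_old EV) //; apply: contraNneq qV => <-.
rewrite big_split /= (_ : \sum_(v in V) (v \in K) = 3); first lia.
rewrite -cK -sum1_card big_mkcond [RHS]big_mkcond; apply: eq_bigr => v _.
by case: (boolP (v \in K)) => [/(subsetP KV) ->|_] //; case: ifP.
Qed.

(** Leaves are pairwise non-adjacent, so each keeps degree 3 while the others are deleted. *)
Lemma three_tree_del_leaves V E S : three_tree_on V E -> 5 <= #|V| ->
  S \subset V -> {in S, forall s, deg E s = 3} -> #|S| + 4 <= #|V| ->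
  three_tree_on (V :\: S) (induced E (V :\: S)).
Proof.
move=> tE V5; have EV := three_tree_pairs tE.
have [n] := ubnP #|S|; elim: n S => // n IH S Sn SV S3 cS.
have [->|[s sS]] := set_0Vmem S; first by rewrite setD0 induced_all.
have cS1 := cardsD1 s S; rewrite sS add1n in cS1.
have subS : S :\ s \subset S by rewrite subD1set.
have {}IH := IH (S :\ s).
have tD : three_tree_on (V :\: (S :\ s)) (induced E (V :\: (S :\ s))).
  apply: IH; rewrite ?(subset_trans subS) //; [lia| |lia].
  by move=> x /(subsetP subS); exact: S3.
have sD : s \in V :\: (S :\ s) by rewrite !inE eqxx (subsetP SV).
have VS : (V :\: (S :\ s)) :\ s = V :\: S.
  apply/setP => x; rewrite !inE; case: eqP => [->|] //=; by rewrite sS.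
have cD : 5 <= #|V :\: (S :\ s)|.
  by rewrite cardsDS ?(subset_trans subS) //; lia.
have d3 : deg (induced E (V :\: (S :\ s))) s = 3.
  rewrite (deg_nb _ (three_tree_pairs tD)) (nb_induced_setI V) // -(S3 s sS) (deg_nb _ EV).
  congr #|pred_of_set _|; apply/setIidPl/subsetP => x xs.
  rewrite inE; have [xV _ _] : [/\ x \in V, s \in V & x != s] by move: xs; rewrite inE => /(pair_mem EV).
  rewrite xV andbT; apply: contraTN xs => /(subsetP subS)/S3 x3.
  exact: three_tree_leaves_apart tE V5 x3 (S3 s sS).
have := three_tree_del tD cD sD d3; rewrite VS induced_induced //.
by rewrite -VS subD1set.
Qed.
End Leaves.

(** * Recolouring near a leaf next to a vertex of degree 4 *)

Lemma two_elements (A : eqType) (s : seq A) x : uniq s -> 2 <= size s ->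
  exists2 y, y \in s & y != x.
Proof.
case: s => [//|a [//|b s]] /= /andP[ab _] _.
have [ax|ax] := eqVneq a x; last by exists a; rewrite ?mem_head.
exists b; first by rewrite !inE eqxx orbT.
by rewrite -ax eq_sym; move: ab; rewrite inE negb_or => /andP[].
Qed.

(** In [end_edges], [c1] and [c2] are the colours of [(0, 1)] and [(0, 2)], while [b1] and [b2] are
    those of [(1, 4)] and [(2, 4)]. *)
Definition completable (B1 B2 : seq nat) (c1 c2 : nat) : Prop :=
  exists b1 b2, [/\ b1 \in B1, b2 \in B2, b1 != c1, b2 != c2 & b1 != b2].

(* If [a1, a2] cannot be completed, then [B1] contains [a1, x] and [B2] contains
   [a2, x] for some [x]. *)
Lemma completable_other (B1 B2 : seq nat) a1 a2 : a1 != a2 ->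
  uniq B1 -> 2 <= size B1 -> uniq B2 -> 2 <= size B2 ->
  completable B1 B2 a1 a2 \/
  forall c1 c2, (c1 != a1) || (c2 != a2) -> completable B1 B2 c1 c2.
Proof.
move=> a12 u1 s1 u2 s2.
have [x xB xa] := two_elements a1 u1 s1; have [y yB ya] := two_elements a2 u2 s2.
have [xy|xy] := eqVneq x y; last by left; exists x, y.
subst y.
have [a1B|a1B] := boolP (a1 \in B1); last first.
  have [z zB zx] := two_elements x u1 s1.
  by left; exists z, x; split=> //; apply: contraNneq a1B => <-.
have [a2B|a2B] := boolP (a2 \in B2); last first.
  have [z zB zx] := two_elements x u2 s2.
  by left; exists x, z; split=> //; [apply: contraNneq a2B => <-|rewrite eq_sym].
right=> c1 c2; have [c1a|c1a] := eqVneq c1 a1 => /= h.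
  by exists x, a2; split; rewrite ?c1a // eq_sym.
have [c2a|c2a] := eqVneq c2 a2.
  by exists a1, x; split; rewrite ?c2a // eq_sym.
by exists a1, a2; split; rewrite // eq_sym.
Qed.

Lemma uniq3 (A : eqType) (x y z : A) : x != y -> x != z -> y != z -> uniq [:: x; y; z].
Proof. by move=> xy xz yz; rewrite /= !inE negb_or xy xz yz. Qed.

(** Take a second colour [b_i] in each list. Move edge 1 to [b1]; an edge displaced by a move goes
    to its own second colour in turn. If this chain gets caught in a cycle of edges 2 and 3, these
    two exchange colours instead. *)
Lemma recolour_triple (A1 A2 A3 : seq nat) a1 a2 a3 :
  uniq A1 -> 2 <= size A1 -> uniq A2 -> 2 <= size A2 -> uniq A3 -> 2 <= size A3 ->
  a1 \in A1 -> a2 \in A2 -> a3 \in A3 -> uniq [:: a1; a2; a3] ->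
  exists c1 c2 c3, [/\ c1 \in A1, c2 \in A2, c3 \in A3, uniq [:: c1; c2; c3] &
    (c1 != a1) || (c2 != a2)].
Proof.
move=> u1 s1 u2 s2 u3 s3 h1 h2 h3 /=; rewrite !inE !negb_or !andbT => /andP[/andP[a12 a13] a23].
have [b1 b1A b1a] := two_elements a1 u1 s1; have [b2 b2A b2a] := two_elements a2 u2 s2.
have [b3 b3A b3a] := two_elements a3 u3 s3.
have [a32 a21 a31] : [/\ a3 != a2, a2 != a1 & a3 != a1] by split; rewrite eq_sym.
have [e1|n1] := eqVneq b1 a3.
  have [e3|n3] := eqVneq b3 a2; last first.
    exists b1, a2, b3; split; rewrite ?b1a //.
    by apply: uniq3; rewrite ?e1 // eq_sym.
  have [e2|n2] := eqVneq b2 a3; last first.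
    exists b1, b2, b3; split; rewrite ?b1a //.
    by apply: uniq3; rewrite ?e1 ?e3 // eq_sym.
  exists a1, b2, b3; split; rewrite ?b2a ?orbT //.
  by apply: uniq3; rewrite ?e2 ?e3.
have [e1|n1'] := eqVneq b1 a2; last first.
  by exists b1, a2, a3; split; rewrite ?b1a //; apply: uniq3.
have [e2|n2] := eqVneq b2 a3; last first.
  exists b1, b2, a3; split; rewrite ?b1a //.
  by apply: uniq3; rewrite ?e1 // eq_sym.
have [e3|n3] := eqVneq b3 a2; last first.
  exists b1, b2, b3; split; rewrite ?b1a //.
  by apply: uniq3; rewrite ?e1 ?e2 // eq_sym.
exists a1, b2, b3; split; rewrite ?b2a ?orbT //.
by apply: uniq3; rewrite ?e2 ?e3.
Qed.

Section Six.
Variable T : finType.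
Implicit Types (V K S U : {set T}) (E F : {set {set T}}) (u v w q x y z : T).

(* Centre 0 has the neighbours 1, 2, 3 and the leaf 4, which is also joined to
   1 and 2. *)
Definition end_edges : seq (nat * nat) := [:: (0, 1); (0, 2); (0, 3); (1, 4); (2, 4); (0, 4)].

(** Centre 0 has degree 4 and the leaf degree 3, so neither has a coloured edge outside the
    configuration. The second colour of [(0, 3)] comes from vertex 3 having degree less than [k]. *)
Definition end_bound (e : nat * nat) : nat := if e == (0, 4) then 6 else 2.

(** If the given colours of the three edges do not extend to [(1, 4)] and [(2, 4)], any change on
    the first two edges helps by [completable_other], and [recolour_triple] makes one. Edge [(0, 4)]
    meets only five others and comes last. *)
Lemma end_extendable : extendable [:: (0, 1); (0, 2); (0, 3)] end_edges end_bound.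
Proof.
move=> R hR [c0 [c0R c0P]].
have hR2 i j : (i, j) \in end_edges -> uniq (R (i, j)) /\ 2 <= size (R (i, j)).
  move=> ij; have /andP[-> h] := hR _ ij; split=> //; apply: leq_trans h.
  by rewrite /end_bound; case: ifP.
have [u1 s1] := hR2 0 1 isT; have [u2 s2] := hR2 0 2 isT; have [u3 s3] := hR2 0 3 isT.
have [v1 t1] := hR2 1 4 isT; have [v2 t2] := hR2 2 4 isT.
have hu : uniq [:: c0 (0, 1); c0 (0, 2); c0 (0, 3)].
  by apply: uniq3; apply/eqP; apply: c0P.
suff [c1 [c2 [c3 [h1 h2 h3 u123 [b1 [b2 [hb1 hb2 b1c b2c b12]]]]]]] : exists c1 c2 c3,
    [/\ c1 \in R (0, 1), c2 \in R (0, 2), c3 \in R (0, 3), uniq [:: c1; c2; c3] &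
        completable (R (1, 4)) (R (2, 4)) c1 c2].
  have /andP[u6 s6] := hR (0, 4) isT.
  have [d dR] : exists d, d \in [seq x <- R (0, 4) | x \notin [:: c1; c2; c3; b1; b2]].
    have := size_filter_notin [:: c1; c2; c3; b1; b2] u6.
    rewrite /end_bound /= in s6; case: filter => [|d s _]; last by exists d; rewrite mem_head.
    by rewrite leqn0 subn_eq0 leqNgt s6.
  move: dR; rewrite mem_filter !inE !negb_or => /andP[/and5P[d1 d2 d3 d4 d5] dR].
  move: u123; rewrite /= !inE !negb_or !andbT => /andP[/andP[c12 c13] c23].
  pose c (e : nat * nat) := nth 0 [:: c1; c2; c3; b1; b2; d] (index e end_edges).
  exists c; split=> [e|].
    by rewrite !inE => /or4P[/eqP->|/eqP->|/eqP->|/or3P[]/eqP->].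
  have cs : all (fun e => all (fun f => conflict e f ==> (c e != c f)) end_edges) end_edges.
    rewrite /= /c /= c12 c13 c23 ![c2 == c1]eq_sym ![c3 == c1]eq_sym ![c3 == c2]eq_sym.
    rewrite c12 c13 c23 b1c b2c b12 d1 d2 d3 d4 d5 ![c1 == b1]eq_sym b1c ![c2 == b2]eq_sym b2c.
    rewrite ![b2 == b1]eq_sym b12 ![c1 == d]eq_sym d1 ![c2 == d]eq_sym d2.
    by rewrite ![c3 == d]eq_sym d3 ![b1 == d]eq_sym d4 ![b2 == d]eq_sym d5.
  move=> e f ee ff ef; have /allP/(_ _ ff) := allP cs _ ee.
  by rewrite ef => /eqP.
have /eqP c012 := c0P (0, 1) (0, 2) isT isT isT.
have [ok|other] := completable_other c012 v1 t1 v2 t2.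
  by exists (c0 (0, 1)), (c0 (0, 2)), (c0 (0, 3)); split=> //; apply: c0R.
have [c1 [c2 [c3 [h1 h2 h3 hu' ne]]]] := recolour_triple u1 s1 u2 s2 u3 s3
  (c0R (0, 1) isT) (c0R (0, 2) isT) (c0R (0, 3) isT) hu.
by exists c1, c2, c3; split=> //; exact: other.
Qed.

Lemma colourable_sub F F' (L : {set T} -> seq nat) : F' \subset F -> colourable F L -> colourable F' L.
Proof.
move=> /subsetP sub [c [cL cP]]; exists c; split=> [e /sub|e f /sub eF /sub fF].
  exact: cL.
exact: cP.
Qed.

Lemma without_star V E w (l : seq {set T}) : E \subset pairs V ->
  {in nb E w, forall a, [set a; w] \in l} ->
  [set g in E | g \notin l] \subset induced E (V :\ w).
Proof.
move=> EV hl; apply/subsetP => g; rewrite !inE => /andP[gE gl]; rewrite gE /=.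
have := subsetP EV _ gE; rewrite inE => /andP[gV /cards2P[a [b [ab gab]]]].
rewrite subsetD1 gV /=; apply: contra gl; rewrite gab !inE => /orP[]/eqP wE.
  by rewrite setUC -wE; apply: hl; rewrite inE wE setUC -gab.
by rewrite -wE; apply: hl; rewrite inE wE -gab.
Qed.

Lemma nb_leaf V E w u x y : E \subset pairs V -> deg E w = 3 -> uniq [:: u; x; y] ->
  {subset [:: u; x; y] <= nb E w} -> nb E w =i [:: u; x; y].
Proof.
move=> EV dw uq sub a; apply/esym; move: a; apply/subset_cardP; last exact/subsetP.
by rewrite -(deg_nb _ EV) dw; apply/card_uniqP.
Qed.

(** The edges from [w] to [y], [x], [u] retain at least 1, 2, 3 colours and are coloured in this
    order. *)
Lemma colourable_light_leaf V E k w u x y (L : {set T} -> seq nat) : E \subset pairs V ->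
  6 <= k -> uniq [:: u; x; y; w] -> {subset [:: u; x; y] <= nb E w} ->
  deg E w = 3 -> deg E u = 4 -> deg E x < k -> deg E y <= k ->
  {in E, forall e, uniq (L e) && (k <= size (L e))} ->
  colourable (induced E (V :\ w)) L -> colourable E L.
Proof.
move=> EV k6 uq sub dw du dx dy hL.
have nbw := nb_leaf EV dw (take_uniq 3 uq) sub.
have inj := @nth_uniq_inj _ u _ uq.
pose C := [:: (2, 3); (1, 3); (0, 3)].
pose f (e : nat * nat) := nth 0 [:: 3; 2; 1] e.1.
have CE : {in C, forall e, img (nth u [:: u; x; y; w]) e \in E}.
  have h a : a \in [:: u; x; y] -> [set a; w] \in E by move=> /sub; rewrite inE.
  by apply/allP; rewrite /= /img /= !h // !inE eqxx ?orbT.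
have ch : choosable C f by apply: (@alon_tarsi_choosable _ _ [:: 0; 1; 2]).
move=> col; apply: (@extend_colouring T 4 _ C inj isT E k [::] f CE) hL _ _ => //.
- apply/allP; rewrite /C /f /= dw du; move: (deg E x) (deg E y) dx dy => a b; clear -k6 => ha hb.
  by do ![apply/andP; split]; lia.
- by move=> R hR _; exact: ch.
apply: colourable_sub (without_star EV _) col => a; rewrite nbw.
by rewrite filter_predT /= !inE => /or3P[]/eqP->; rewrite /img /= eqxx ?orbT.
Qed.

Lemma colourable_end V E k w u x y z (L : {set T} -> seq nat) : E \subset pairs V ->
  6 <= k -> uniq [:: u; x; y; z; w] -> {subset [:: u; x; y] <= nb E w} ->
  z \in nb E u -> x \in nb E u -> y \in nb E u ->
  deg E w = 3 -> deg E u = 4 -> deg E x <= k -> deg E y <= k -> deg E z < k ->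
  {in E, forall e, uniq (L e) && (k <= size (L e))} ->
  colourable (induced E (V :\ w)) L -> colourable E L.
Proof.
move=> EV k6 uq sub zu xu yu dw du dx dy dz hL.
have uq3 : uniq [:: u; x; y] by exact: take_uniq 3 uq.
have nbw := nb_leaf EV dw uq3 sub.
have inj := @nth_uniq_inj _ u _ uq.
have CE : {in end_edges, forall e, img (nth u [:: u; x; y; z; w]) e \in E}.
  have h a : a \in [:: u; x; y] -> [set a; w] \in E by move=> /sub; rewrite inE.
  have h' a : a \in nb E u -> [set u; a] \in E by rewrite inE setUC.
  apply/allP; rewrite /= /img /= !(h' x) // !(h' y) // !(h' z) //.
  by rewrite !h // !inE eqxx ?orbT.
move=> col; apply: (@extend_colouring T 5 _ end_edges inj isT E k
    [:: (0, 1); (0, 2); (0, 3)] end_bound CE) hL end_extendable _ => //.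
- by move=> e; rewrite !inE => /or3P[]->; rewrite ?orbT.
- apply/allP; rewrite /end_edges /end_bound /= dw du.
  move: (deg E x) (deg E y) (deg E z) dx dy dz => a b c; clear -k6 => ha hb hc.
  by do ![apply/andP; split]; lia.
apply: colourable_sub (without_star EV _) col => a; rewrite nbw.
by rewrite /= !inE => /or3P[]/eqP->; rewrite /img /= eqxx ?orbT.
Qed.
End Six.

(** * Finding a reducible leaf by counting degrees *)

Section MaxDegreeSix.
Variable T : finType.
Implicit Types (V K S U : {set T}) (E F : {set {set T}}) (u v w q x y z : T).

Definition leaves V E : {set T} := [set v in V | deg E v == 3].

Definition light_end E w u x y z : Prop :=
  [/\ uniq [:: u; x; y; z; w], {subset [:: u; x; y] <= nb E w},
      {subset [:: x; y; z] <= nb E u}, deg E w = 3 /\ deg E u = 4 &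
      [|| deg E x < 6, deg E y < 6 | deg E z < 6]].

(** Suppose [x], [y], [z] all have degree at least 6. Delete [u] from the tree on [U] and take a
    leaf [q] other than [u']. Beyond its three neighbours there, [q] can only be adjacent to [w] and
    [u], so its degree in [E] is 4 or 5. It is thus adjacent to [w] or [u], hence one of [x], [y],
    [z]: a contradiction. *)
Lemma light_end_unique_leaf V E u u' (U := V :\: leaves V E) :
  three_tree_on V E -> 5 <= #|V| -> three_tree_on U (induced E U) -> 6 <= #|U| ->
  u \in U -> u' \in U -> u != u' -> #|nb E u :&: U| = 3 -> #|nb E u' :&: U| = 3 ->
  #|nb E u :&: leaves V E| = 1 -> leaves V E \subset nb E u :|: nb E u' ->
  exists w x y z, light_end E w u x y z.
Proof.
move=> tE V5 tH U6 uU u'U uu' nu nu' /eqP/cards1P[w wE] Scov.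
have EV := three_tree_pairs tE; have EH := three_tree_pairs tH.
have UV : U \subset V by exact: subsetDl.
have uS v : v \in U -> v \in leaves V E = false by rewrite inE => /andP[/negbTE].
have [wu wS] : w \in nb E u /\ w \in leaves V E by apply/andP; rewrite -in_setI wE set11.
have Suw s : s \in nb E u -> s \in leaves V E -> s = w.
  by move=> h1 h2; apply/set1P; rewrite -wE in_setI h1.
have nbV a b : a \in nb E b -> [/\ a \in V, b \in V & a != b].
  by rewrite inE => /(pair_mem EV).
have dw : deg E w = 3 by move: wS; rewrite inE => /andP[_ /eqP].
have clique s a b : s \in leaves V E -> a \in nb E s -> b \in nb E s -> a != b -> a \in nb E b.
  rewrite inE => /andP[_ /eqP ds] a_s b_s; exact: (three_tree_leaf_clique tE ds a_s b_s).
have split_deg v : deg E v = #|nb E v :&: leaves V E| + #|nb E v :&: U|.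
  rewrite (deg_nb _ EV) -(cardsID (leaves V E) (nb E v)); congr (_ + #|pred_of_set _|).
  apply/setP => a; rewrite !in_setD in_setI in_setD andbC.
  by case: (boolP (a \in nb E v)) => //= /nbV[-> _ _]; rewrite andbT.
have du : deg E u = 4 by rewrite split_deg wE cards1 nu.
have uw : u \in nb E w by rewrite nb_sym.
have /cards2P[x [y [xy xyE]]] : #|nb E w :\ u| == 2.
  by have := cardsD1 u (nb E w); rewrite uw -(deg_nb _ EV) dw add1n => -[<-].
have [xw yw] : x \in nb E w :\ u /\ y \in nb E w :\ u by rewrite xyE !inE !eqxx orbT.
move: xw yw; rewrite !in_setD1 => /andP[xu xw] /andP[yu yw].
have xnu : x \in nb E u by exact: clique wS xw uw xu.
have ynu : y \in nb E u by exact: clique wS yw uw yu.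
have inU a : a \in nb E u -> a != w -> a \in U.
  move=> au aw; have [aV _ _] := nbV _ _ au; rewrite inE aV andbT.
  by apply: contra aw => aS; rewrite (Suw a).
have [_ _ xw'] := nbV _ _ xw; have [_ _ yw'] := nbV _ _ yw.
have [xU yU] : x \in U /\ y \in U by split; apply: inU.
have /cards1P[z zE] : #|(nb E u :&: U) :\: [set x; y]| == 1.
  by rewrite cardsDS ?nu ?cards2 ?xy // subUset !sub1set !in_setI xnu ynu xU yU.
have : z \in (nb E u :&: U) :\: [set x; y] by rewrite zE set11.
rewrite in_setD in_setI in_set2 negb_or => /andP[/andP[zx zy] /andP[znu zU]].
have zw : z != w by apply: contraTneq wS => <-; rewrite uS.
have nbw a : a \in nb E w -> a \in [:: u; x; y].
  move=> aw; have : a \in u |: (nb E w :\ u) by rewrite setD1K.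
  by rewrite xyE !inE.
have nbu a : a \in nb E u -> a \in U -> a \in [:: x; y; z].
  move=> au aU; have [axy|axy] := boolP (a \in [set x; y]).
    by move: axy; rewrite !inE => /orP[]->; rewrite ?orbT.
  have : a \in (nb E u :&: U) :\: [set x; y] by rewrite in_setD axy in_setI au.
  by rewrite zE !inE => ->; rewrite !orbT.
exists w, x, y, z; split=> //.
- rewrite /= !inE !negb_or ![u == _]eq_sym xu yu xy ![_ == z]eq_sym zx zy xw' yw' zw.
  by have [_ _ ->] := nbV _ _ znu; have [_ _ ->] := nbV _ _ wu.
- by move=> a; rewrite !inE => /or3P[]/eqP->; rewrite -?in_set //; move: uw xw yw; rewrite !inE.
- by move=> a; rewrite !inE => /or3P[]/eqP->; move: xnu ynu znu; rewrite !inE.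
apply: contraT; rewrite !negb_or -!leqNgt => /and3P[dx dy dz].
have heavy a : a \in [:: u; x; y] ++ [:: x; y; z] -> a \in U :\ u -> 6 <= deg E a.
  move=> axyz; rewrite in_setD1 => /andP[/negbTE au _]; move: axyz.
  by rewrite mem_cat !inE au /= => /orP[/orP[]|/or3P[]] /eqP->.
have dHu : deg (induced E U) u = 3 by rewrite (deg_nb _ EH) (nb_induced_setI V).
have tK := three_tree_del tH (ltnW U6) uU dHu.
rewrite induced_induced ?subD1set // in tK.
have EK := three_tree_pairs tK.
have K5 : 5 <= #|U :\ u| by have := cardsD1 u U; rewrite uU add1n => h; rewrite -ltnS -h.
have u'K : u' \in U :\ u by rewrite in_setD1 eq_sym uu'.
have dHu' : deg (induced E U) u' = 3 by rewrite (deg_nb _ EH) (nb_induced_setI V).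
have uu'n : u \notin nb E u'.
  have := three_tree_leaves_apart tH (ltnW U6) dHu dHu'.
  by rewrite (nb_induced_setI V) // in_setI uU andbT.
have dKu' : deg (induced E (U :\ u)) u' = 3.
  rewrite (deg_nb _ EK) (nb_induced_setI V) // -nu'; apply: eq_card => a.
  rewrite !in_setI in_setD1; case: (eqVneq a u) => [->|_] //=.
  by rewrite (negbTE uu'n).
have [q [qK qu' dKq]] : exists q, [/\ q \in U :\ u, q != u' & deg (induced E (U :\ u)) q = 3].
  have [a [b [aK bK ab [da db]]]] := three_tree_two_leaves tK K5.
  have [au'|au'] := eqVneq a u'; last by exists a.
  by exists b; rewrite -au' eq_sym.
have qu'n : q \notin nb E u'.
  have := three_tree_leaves_apart tK K5 dKq dKu'.
  by rewrite (nb_induced_setI V) // in_setI qK andbT.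
have qU : q \in U by move: qK; rewrite in_setD1 => /andP[].
have qV : q \in V by exact: subsetP UV _ qU.
have dKqE : #|nb E q :&: (U :\ u)| = 3 by rewrite -dKq (deg_nb _ EK) (nb_induced_setI V).
(* A leaf next to both [q] and [u'] would make them adjacent, as its neighbours form a clique; so a
   leaf next to [q] is next to [u], and is [w]. *)
have nbq : nb E q \subset (nb E q :&: (U :\ u)) :|: [set w; u].
  apply/subsetP => a aq; have [aV _ _] := nbV _ _ aq.
  rewrite in_setU in_setI aq in_set2 in_setD1 in_setD aV.
  have [->|au] := eqVneq a u; first by rewrite orbT.
  have [aS|aS] := boolP (a \in leaves V E) => //=; rewrite orbF.
  have := subsetP Scov _ aS; rewrite in_setU => /orP[/Suw->//|au'].
  case/negP: qu'n; apply: clique aS _ _ qu'; by rewrite nb_sym.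
have d4 : 4 <= deg E q.
  have := three_tree_min_deg tE qV; rewrite leq_eqVlt => /predU1P[d3|//].
  by have := uS q qU; rewrite inE qV -d3 eqxx.
have d5 : deg E q <= 5.
  rewrite (deg_nb _ EV) (leq_trans (subset_leq_card nbq)) // cardsU dKqE.
  by rewrite (leq_trans (leq_subr _ _)) // cards2; case: (w == u).
suff : q \in [:: u; x; y] ++ [:: x; y; z].
  by move=> /heavy/(_ qK); rewrite leqNgt ltnS d5.
rewrite mem_cat; apply/orP.
have [wq|wq] := boolP (w \in nb E q); first by left; apply: nbw; rewrite nb_sym.
have [uq|uq] := boolP (u \in nb E q); first by right; apply: nbu; rewrite // nb_sym.
move: d4; rewrite (deg_nb _ EV) leqNgt ltnS -dKqE subset_leq_card //.
apply/subsetP => a aq; have := subsetP nbq _ aq; rewrite in_setU in_set2 => /or3P[//||] /eqP aE.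
  by rewrite aE (negbTE wq) in aq.
by rewrite aE (negbTE uq) in aq.
Qed.

Lemma degree_deficit V E (X : {set T}) : three_tree_on V E -> (forall u, deg E u <= 6) ->
  X \subset V -> \sum_(v in X) (6 - deg E v) <= 12.
Proof.
move=> tE d6 XV; have := three_tree_degree_sum tE.
have : \sum_(v in V) (6 - deg E v) + \sum_(v in V) deg E v = 6 * #|V|.
  rewrite -big_split /= (eq_bigr (fun=> 6)); first by rewrite sum_nat_const mulnC.
  by move=> v _; rewrite subnK.
rewrite (big_setID X) /= (setIidPr XV).
move: (\sum_(v in X) _) (\sum_(v in V :\: X) _) (\sum_(v in V) _); clear; lia.
Qed.

Lemma exists_light_end V E : three_tree_on V E -> 9 <= #|V| -> (forall u, deg E u <= 6) ->
  exists w u x y z, light_end E w u x y z.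
Proof.
move=> tE V9 d6; have EV := three_tree_pairs tE.
pose S := leaves V E; pose U := V :\: S.
have SV : S \subset V by apply/subsetP => v; rewrite inE => /andP[].
have S3 : {in S, forall s, deg E s = 3} by move=> s; rewrite inE => /andP[_ /eqP].
have V5 : 5 <= #|V| by exact: leq_trans V9.
have sumS (X : {set T}) : X \subset S -> \sum_(v in X) (6 - deg E v) = 3 * #|X|.
  move=> XS; rewrite (eq_bigr (fun=> 3)) => [|v /(subsetP XS)/S3-> //].
  by rewrite sum_nat_const mulnC.
have cS : #|S| <= 4.
  by have := degree_deficit tE d6 SV; rewrite sumS //; clear; lia.
have cU : #|U| = #|V| - #|S| by rewrite cardsDS.
have tH : three_tree_on U (induced E U).
  by apply: three_tree_del_leaves => //; clear -cS V9; lia.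
have U5 : 5 <= #|U| by rewrite cU; clear -cS V9; lia.
have EH := three_tree_pairs tH.
have [u [u' [uU u'U uu' [du du']]]] := three_tree_two_leaves tH U5.
have apart : u \notin nb E u'.
  by have := three_tree_leaves_apart tH U5 du du'; rewrite (nb_induced_setI V) // in_setI uU andbT.
have nU v : v \in U -> deg (induced E U) v = 3 -> #|nb E v :&: U| = 3.
  by move=> vU; rewrite (deg_nb _ EH) (nb_induced_setI V).
have split_deg v : deg E v = #|nb E v :&: S| + #|nb E v :&: U|.
  rewrite (deg_nb _ EV) -(cardsID S (nb E v)); congr (_ + #|pred_of_set _|).
  apply/setP => a; rewrite !in_setD in_setI in_setD andbC.
  by case: (boolP (a \in nb E v)) => //=; rewrite inE => /(pair_mem EV)[-> _ _]; rewrite andbT.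
have pos v : v \in U -> deg (induced E U) v = 3 -> 0 < #|nb E v :&: S|.
  move=> vU /(nU v vU) nv; rewrite lt0n; apply: contraTneq vU => p0.
  by rewrite in_setD negb_and negbK inE split_deg p0 nv andbT; case: (v \in V).
pose A := nb E u :&: S; pose A' := nb E u' :&: S; pose R := S :\: (A :|: A').
have AA' : [disjoint A & A'].
  apply/pred0P => s /=; apply/negP => /andP[]; rewrite !in_setI => /andP[su sS] /andP[su' _].
  by case/negP: apart; apply: (three_tree_leaf_clique tE (S3 s sS)); rewrite // nb_sym.
have AS : A \subset S by exact: subsetIr.
have A'S : A' \subset S by exact: subsetIr.
(* Since [deg E u = #|A| + 3], and likewise for [u'], this amounts to
   [2 * #|A| + 2 * #|A'| + 3 * #|R| <= 6]. As [A] and [A'] are nonempty, [R] is empty and one of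
   them is a singleton. *)
have sumSplit : 6 - deg E u + (6 - deg E u') + 3 * (#|A| + #|A'| + #|R|) <= 12.
  have SE : #|S| = #|A| + #|A'| + #|R|.
    by rewrite -(cardsID (A :|: A') S) (setIidPr _) ?subUset ?AS // cardsU (disjoint_setI0 AA') cards0 subn0.
  have uS v : v \in U -> v \notin S by rewrite in_setD => /andP[].
  have uuS : u \notin u' |: S by rewrite in_setU1 negb_or uu' uS.
  rewrite -SE -(sumS S) // -addnA -big_setU1 ?uS //= -big_setU1 //=.
  apply: (degree_deficit tE d6); rewrite !subUset !sub1set SV.
  by rewrite !(subsetP (subsetDl V S)).
have pu := pos u uU du; have pu' := pos u' u'U du'.
have du6 := d6 u; have du6' := d6 u'.
rewrite !split_deg !nU // -/A -/A' in sumSplit du6 du6' pu pu'.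
have R0 : R = set0.
  apply/eqP; rewrite -cards_eq0; clear -sumSplit pu pu' du6 du6'; lia.
have Scov : S \subset nb E u :|: nb E u'.
  have : S \subset A :|: A' by rewrite -setD_eq0 -/R R0.
  by move=> /subset_trans; apply; rewrite setUSS ?subsetIl.
have cSle : #|S| <= 3.
  rewrite -(cardsID (A :|: A') S) -/R R0 cards0 addn0 (setIidPr _) ?subUset ?AS //.
  rewrite cardsU; clear -sumSplit pu pu' du6 du6'; lia.
have U6 : 6 <= #|U| by rewrite cU; clear -cSle V9; lia.
have [pu1|pu1] : #|A| = 1 \/ #|A'| = 1 by clear -sumSplit pu pu' du6 du6'; lia.
  have [w [x [y [z h]]]] := light_end_unique_leaf tE V5 tH U6 uU u'U uu' (nU u uU du)
    (nU u' u'U du') pu1 Scov.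
  by exists w, u, x, y, z.
rewrite setUC in Scov; rewrite eq_sym in uu'.
have [w [x [y [z h]]]] := light_end_unique_leaf tE V5 tH U6 u'U uU uu' (nU u' u'U du')
  (nU u uU du) pu1 Scov.
by exists w, u', x, y, z.
Qed.

Theorem edges_choosable_six V E : three_tree_on V E -> 7 <= #|V| -> (forall u, deg E u <= 6) ->
  edges_choosable E 6.
Proof.
have [n] := ubnP #|V|; elim: n V E => // n IH V E Vn tE V7 d6.
have [V8|V9] := leqP #|V| 8; first by apply: (small_choosable tE) => //; rewrite V7.
have EV := three_tree_pairs tE; have V5 : 5 <= #|V| by exact: leq_trans V9.
have [w [u [x [y [z [uq subw subu [dw du] light]]]]]] := exists_light_end tE V9 d6.
have wV : w \in V.
  by have /subw : u \in [:: u; x; y]; rewrite inE ?eqxx // => /(pair_mem EV)[].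
have cV := cardsD1 w V; rewrite wV add1n in cV.
move=> L hL; have col : colourable (induced E (V :\ w)) L.
  apply: (IH (V :\ w)); rewrite -?cV //.
  - exact: three_tree_del.
  - by rewrite cV in V9; exact: ltnW.
  - move=> a; apply: leq_trans (d6 a); apply: deg_sub; apply/subsetP => e.
    by rewrite inE => /andP[].
  - by move=> e; rewrite inE => /andP[/hL].
have [xu yu zu] : [/\ x \in nb E u, y \in nb E u & z \in nb E u].
  by split; apply: subu; rewrite !inE eqxx ?orbT.
have uq' : uniq [:: u; x; y; w].
  by apply: subseq_uniq uq; rewrite /= !eqxx; case: (w == z); rewrite /= ?eqxx.
case/or3P: light => [dx|dy|dz].
- exact: (colourable_light_leaf EV _ uq' subw dw du dx (d6 y) hL col).
- have uq'' : uniq [:: u; y; x; w].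
    by rewrite (perm_uniq (s2 := [:: u; x; y; w])) // perm_cons -[[:: y; x; w]]/([:: y] ++ [:: x] ++ [:: w]) perm_catCA.
  apply: (colourable_light_leaf EV _ uq'' _ dw du dy (d6 x) hL col) => // a.
  by rewrite !inE [(a == y) || _]orbC => h; move: (subw a); rewrite !inE; exact.
- exact: (colourable_end EV _ uq subw zu xu yu dw du (d6 x) (d6 y) dz hL col).
Qed.
End MaxDegreeSix.

(** * Lower bounds on the number of colours, and the conclusion *)

Section Final.
Variable T : finType.
Implicit Types (V : {set T}) (E : {set {set T}}) (G : sgraph T).

Lemma edges_choosable_leq E k m : k <= m -> edges_choosable E k -> edges_choosable E m.
Proof.
move=> km ch L hL; apply: ch => e /hL/andP[-> h]; exact: leq_trans h.
Qed.

(** A possibly infinite list is replaced by [k] of its members, picked one by one with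
    [card_le_fresh]. *)
Lemma edge_choosable_of_edges G k : edges_choosable (edges G) k -> edge_choosable G k.
Proof.
move=> ch L hL.
have [l lP] : exists l : {set T} -> seq nat, forall e, e \in edges G ->
    [/\ uniq (l e), size (l e) = k & forall x, x \in l e -> L e x].
  apply: (fin_all_exists (P := fun e s => e \in edges G ->
    [/\ uniq s, size s = k & forall x, x \in s -> L e x])) => e.
  have [eG|] := boolP (e \in edges G); last by exists [::].
  suff [s sP] : exists s, [/\ uniq s, size s = k & forall x, x \in s -> L e x] by exists s.
  elim: {-2}k (leqnn k) => [_|j IH jk]; first by exists [::].
  have [s [us szs sL]] := IH (ltnW jk).
  have sk : size s < k by rewrite szs.
  have [x Lx xs] := card_le_fresh (hL e eG) sk.
  exists (x :: s); split; rewrite /= ?xs ?szs // => y.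
  by rewrite inE => /predU1P[->|/sL].
have [|c [cl cP]] := ch l; first by move=> e /lP[-> -> _]; rewrite leqnn.
exists c; split=> [e eG|e f eG fG]; last exact: cP.
by have [_ _ h] := lP e eG; apply/h/cl.
Qed.

Lemma edge_colourable_deg G k v : edge_colourable G k -> deg (edges G) v <= k.
Proof.
move=> [c [ck cP]]; rewrite /deg cardE -(size_map c) -[leqRHS](size_iota 0).
apply: uniq_leq_size.
  rewrite map_inj_in_uniq ?enum_uniq // => e f.
  rewrite !mem_enum !inE => /andP[eG ve] /andP[fG vf] cef.
  apply/eqP/negPn/negP => ef; apply: (cP e f eG fG _ cef).
  by rewrite /adjacent_edges ef; apply/set0Pn; exists v; rewrite inE ve.
move=> _ /mapP[e + ->]; rewrite mem_enum inE => /andP[/ck eG _].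
by rewrite mem_iota.
Qed.

(** Each colour class is a matching. This serves K5 minus an edge, whose maximum degree 4 would not
    give the bound 5. *)
Lemma edge_colourable_size G k : edge_colourable G k ->
  #|edges G| <= k * #|vertices G|./2.
Proof.
move=> [c [ck cP]].
have -> : #|edges G| = \sum_(i < k) #|[set e in edges G | c e == i]|.
  rewrite -sum1_card; under [RHS]eq_bigr => i _ do rewrite -sum1dep_card big_mkcondr /=.
  rewrite exchange_big /=; apply: eq_bigr => e eG.
  rewrite (bigD1 (Ordinal (ck e eG))) //= eqxx big1 // => i; rewrite -val_eqE /= eq_sym.
  by move=> /negbTE->.
rewrite -[k in k * _]card_ord -sum_nat_const; apply: leq_sum => i _.
set M := [set e in _ | _].
have MG e : e \in M -> e \in edges G by rewrite inE => /andP[].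
have M2 e : e \in M -> #|e| = 2 by move=> /MG; exact: card_pair (edges_pairs G).
have tM : trivIset M.
  apply/trivIsetP => e f eM fM ef; rewrite -setI_eq0; apply: contraT => ef0.
  have := cP e f (MG e eM) (MG f fM); rewrite /adjacent_edges ef ef0 => /(_ isT).
  by move: eM fM; rewrite !inE => /andP[_ /eqP->] /andP[_ /eqP->].
have : \sum_(e in M) #|e| <= #|vertices G|.
  rewrite (eqP tM) subset_leq_card //; apply/bigcupsP => e /MG eG.
  by have := subsetP (edges_pairs G) _ eG; rewrite inE => /andP[].
by rewrite (eq_bigr (fun=> 2)) // sum_nat_const muln2 => h; rewrite geq_half_double.
Qed.

Lemma drawn_size V E n C : drawn V E n C -> #|E| = size C.
Proof.
move=> [phi [inj wf _ EC]]; rewrite (eq_card EC) -(size_map (img phi)).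
apply/card_uniqP; rewrite map_inj_in_uniq; first by case/andP: wf.
exact: img_inj inj wf.
Qed.

Lemma three_tree_choosable G k : three_tree G -> edge_colourable G k ->
  edges_choosable (edges G) k.
Proof.
move=> tG col; have degk v := edge_colourable_deg v col.
have EV := edges_pairs G.
have [V7|V7] := leqP 7 #|vertices G|.
  have [u du] := max_deg_large tG V7.
  have : 6 <= k by exact: leq_trans (degk u).
  rewrite leq_eqVlt => /predU1P[k6|k7]; last exact: edges_choosable_large tG _ k7 degk.
  by rewrite -k6; apply: (edges_choosable_six tG V7); rewrite k6.
have d6 u : deg (edges G) u <= 6.
  rewrite (deg_nb _ EV) -ltnS; apply: leq_trans V7.
  by rewrite ltnS; apply/subset_leq_card/subsetP => v; rewrite inE => /(pair_mem EV)[].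
have [x xin [ordx dr]] := small_classification tG (leqW (ltnW V7)) d6.
have [_ ch _ n5 nn5] := small_treesP xin.
apply: edges_choosable_leq (drawn_choosable dr ch).
have [o5|o5] := eqVneq (order_of x) 5.
  have [sz ->] := n5 o5; have := edge_colourable_size col.
  rewrite (drawn_size dr) sz -ordx o5 => h; have {h} : 9 <= k * 2 by exact: h.
  by clear; lia.
have [i i_n <-] := nn5 (elimN eqP o5).
by case: dr => phi [inj wf _ EC]; rewrite -(drawn_deg inj wf EC i_n).
Qed.
End Final.

Theorem theorem2 (T : finType) (G : sgraph T) (hG : three_tree G) :
  list_chromatic_index G = chromatic_index G.
Proof.
rewrite /list_chromatic_index /chromatic_index.
case: ex_minnP => m /boolp.asboolP chm minm; case: ex_minnP => k /boolp.asboolP colk mink.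
apply/eqP; rewrite eqn_leq; apply/andP; split.
  apply/minm/boolp.asboolP/edge_choosable_of_edges; exact: three_tree_choosable.
by apply/mink/boolp.asboolP/chm => e _; exact: cardinality.card_lexx.
Qed.
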